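(* Let $k$ be a field and $\Lambda$ a $k$-algebra. Then the following are equivalent: (a) $\Lambda$ can be lifted, its Jacobson radical $r=r(\Lambda)$ is nilpotent, and $\Lambda$ has a gm unit $\{e'_{ii}\}_{i\in I}$ such that for each $i\in I$ the image $\overline{e'_{ii}}=e'_{ii}+r$ lies in the center of $\bar\Lambda=\Lambda/r$; (b) $\Lambda$ is isomorphic (as a $k$-algebra) to a generalized path algebra with weak relations $k(D,\Omega,\rho)$.
   Context: Algebras are associative over the field $k$ and need not have a unity element; $r(\Lambda)$ denotes the Jacobson radical. An algebra $\Lambda$ *can be lifted* if there is a subalgebra $A$ of $\Lambda$ with $\Lambda=A\oplus r(\Lambda)$ as vector spaces. *gm unit.* Let $I$ be a non-empty set. A family $\{e_{ii}\}_{i\in I}$ is a generalized matrix unit (gm unit) of $\Lambda$ if there are subspaces $\Lambda_{ij}$ ($i,j\in I$) with $\Lambda=\bigoplus_{i,j\in I}\Lambda_{ij}$ as vector spaces, $\Lambda_{ij}\Lambda_{jl}\subseteq\Lambda_{il}$, $\Lambda_{ij}\Lambda_{st}=0$ if $j\ne s$, and $0\neq e_{ii}\in\Lambda_{ii}$, $e_{ii}x=x=xe_{jj}$ for all $x\in \Lambda_{ij}$. *Generalized path algebras.* Let $D$ be a directed graph (possibly infinite, loops and multiple arrows allowed) with non-empty vertex set $I=D_0$ and arrow set $D_1$. Let $\Omega=\bigoplus_{i\in I}\Omega_{ii}$ be a direct sum of $k$-algebras ($\Omega_{ii}\Omega_{jj}=0$ for $i\neq j$), each $\Omega_{ii}$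 having a non-zero unity element $e_{ii}$ and $r(\Omega_{ii})=0$. An $\Omega$-path from $i_0$ to $i_n$ of length $n\ge 1$ is a sequence $a_{i_0}x_{i_0i_1}a_{i_1}x_{i_1i_2}\cdots x_{i_{n-1}i_n}a_{i_n}$ with $x_{i_{p-1}i_p}$ an arrow from $i_{p-1}$ to $i_p$ and $0\ne a_{i_p}\in\Omega_{i_pi_p}$. For $i,j\in I$ let $A_{ij}$ be the $k$-space spanned by the $\Omega$-paths of positive length from $i$ to $j$ modulo the relations making them $k$-multilinear in the entries $a_{i_p}$ (a path with a zero entry being $0$), together with $\Omega_{ii}$ as an additional direct summand when $i=j$. The generalized path algebra is $k(D,\Omega)=\bigoplus_{i,j\in I}A_{ij}$, with multiplication by concatenation: the product of a path ending with $a_{i_n}$ and a path starting with $b_{j_0}$ is the path obtained by joining them with middle entry $a_{i_n}b_{j_0}$ if $i_n=j_0$, and is $0$ if $i_n\ne j_0$; elements of $\Omega_{ii}$ multiply into the first or last entry, and $\Omega$ is a subalgebra. An arrow $x$ from $i$ to $j$ is identified with $e_{ii}xe_{jj}$. Let $J$ be the ideal of $k(D,\Omega)$ generated by all arrows. For a non-empty subset $\rho\subseteq k(D,\Omega)$ let $(\rho)$ be the ideal it generates and $k(D,\Omega,\rho)=k(D,\Omega)/(\rho)$. It is a generalized path algebra *with weak relations* if $J^t\subseteq(\rho)\subseteq J$ for some positive integer $t$. *)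

(* Defs.v *)
From HB Require Import structures.
From mathcomp Require Import all_boot all_algebra.
From mathcomp Require Import generic_quotient.
From mathcomp Require Import boolp classical_sets.
From mathcomp Require Import finmap.
From mathcomp.multinomials Require Import monalg.

Set Implicit Arguments.
Unset Strict Implicit.
Unset Printing Implicit Defensive.

Import GRing.Theory.

Local Open Scope ring_scope.
Local Open Scope classical_set_scope.
Local Open Scope quotient_scope.

Reserved Notation "x ** y" (at level 40, left associativity).

(* Associative k-algebras, not necessarily with a unity element. *)
HB.mixin Record Lmodule_isNuAlgebra (k : fieldType) V of GRing.Lmodule k V := {
  numul : V -> V -> V;
  numulA : associative numul;
  numulDl : left_distributive numul +%R;
  numulDr : right_distributive numul +%R;
  numulZl : forall (c : k) (x y : V), numul (c *: x) y = c *: numul x y;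
  numulZr : forall (c : k) (x y : V), numul x (c *: y) = c *: numul x y
}.

#[short(type="nuAlgType")]
HB.structure Definition NuAlgebra (k : fieldType) :=
  {V of Lmodule_isNuAlgebra k V & GRing.Lmodule k V}.

Notation "x ** y" := (numul x y) : ring_scope.

Definition nu (k : fieldType) (A : algType k) : Type := A.

HB.instance Definition _ (k : fieldType) (A : algType k) :=
  GRing.Lmodule.on (nu A).
HB.instance Definition _ (k : fieldType) (A : algType k) :=
  @Lmodule_isNuAlgebra.Build k (nu A) (fun x y : A => x * y)
    (@mulrA A) (@mulrDl A) (@mulrDr A)
    (fun c x y => esym (scalerAl c (x : A) y))
    (fun c x y => esym (scalerAr c (x : A) y)).

Section Subspaces.
Variables (k : fieldType) (V : lmodType k).

Definition subspace (U : set V) : Prop :=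
  U 0 /\ forall (c : k) (x y : V), U x -> U y -> U (c *: x + y).

Definition lspan (S : set V) : set V := smallest subspace S.

(* V is the internal direct sum of the subspaces W t, for t in an arbitrary
   (possibly infinite) index type. *)
Definition direct_sum (T : Type) (W : T -> set V) : Prop :=
  [/\ forall t, subspace (W t),
      forall x, exists n (t : 'I_n -> T) (v : 'I_n -> V),
        (forall m, W (t m) (v m)) /\ x = \sum_m v m
    & forall n (t : 'I_n -> T) (v : 'I_n -> V), injective t ->
        (forall m, W (t m) (v m)) -> \sum_m v m = 0 -> forall m, v m = 0].

Lemma subspaceD U x y : subspace U -> U x -> U y -> U (x + y).
Proof. by case=> _ h Ux Uy; rewrite -[x]scale1r; apply: h. Qed.

Lemma subspaceZ U c x : subspace U -> U x -> U (c *: x).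
Proof. by case=> U0 h Ux; rewrite -[_ *: _]addr0; apply: h. Qed.

Lemma subspaceN U x : subspace U -> U x -> U (- x).
Proof. by rewrite -scaleN1r; apply: subspaceZ. Qed.

Lemma subspaceB U x y : subspace U -> U x -> U y -> U (x - y).
Proof. by move=> sU Ux Uy; apply: subspaceD => //; apply: subspaceN. Qed.

Lemma subspace_lspan S : subspace (lspan S).
Proof.
split=> [U [[]]//|c x y Sx Sy U [sU SU]].
by case: (sU) => _; apply; [apply: Sx|apply: Sy].
Qed.

End Subspaces.

Section Ideals.
Variables (k : fieldType) (A : nuAlgType k).
Implicit Types (U S : set A) (x y : A).

Definition is_left_ideal U : Prop :=
  subspace U /\ forall x y, U y -> U (x ** y).

Definition is_ideal U : Prop :=
  subspace U /\ forall x y, U y -> U (x ** y) /\ U (y ** x).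

Record ideal := Ideal { ideal_set :> set A; idealP : is_ideal ideal_set }.

Lemma is_ideal_smallest S : is_ideal (smallest is_ideal S).
Proof.
split=> [|x y Sy].
  split=> [U [[[]]]//|c x y Sx Sy U [iU SU]].
  by case: (iU) => -[_ h] _; apply: h; [apply: Sx|apply: Sy].
by split=> U [iU SU]; case: (iU) => _ /(_ x y) []//; apply: Sy.
Qed.

Definition gideal S : ideal := Ideal (is_ideal_smallest S).

Definition idealM (U S : set A) : set A :=
  lspan [set z | exists x y, [/\ U x, S y & z = x ** y]].

(* The power U^n; it is only meant for n > 0. *)
Definition idealX U (n : nat) : set A := iter n.-1 (idealM U) U.

Definition nilpotent U : Prop :=
  exists n, (0 < n)%N /\ idealX U n `<=` [set 0].

Definition central x : Prop := forall y, x ** y = y ** x.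

Definition subalgebra (B : set A) : Prop :=
  subspace B /\ forall x y, B x -> B y -> B (x ** y).

(* In the absence of a unity element, the left ideals that matter for the
   Jacobson radical are the modular (or regular) ones. *)
Definition modular U : Prop := exists e, forall x, U (x - x ** e).

Definition maximal_modular U : Prop :=
  [/\ is_left_ideal U, modular U, U != setT
    & forall S, is_left_ideal S -> U `<=` S -> S = U \/ S = setT].

Definition jradical_set : set A := \bigcap_(U in maximal_modular) U.

Lemma left_ideal_sum U S : is_left_ideal U -> is_left_ideal S ->
  is_left_ideal [set x | exists y z, [/\ U y, S z & x = y + z]].
Proof.
move=> [sU mU] [sS mS]; split; last first.
  move=> x _ [y [z [Uy Sz ->]]]; exists (x ** y), (x ** z).
  by rewrite numulDr; split; auto.
split; first by exists 0, 0; rewrite addr0; split=> //; [case: sU|case: sS].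
move=> c _ _ [y [z [Uy Sz ->]]] [y' [z' [Uy' Sz' ->]]].
exists (c *: y + y'), (c *: z + z'); split; first by case: sU => _; apply.
  by case: sS => _; apply.
by rewrite scalerDr addrACA.
Qed.

Lemma numul0r x : 0 ** x = 0.
Proof. by have := numulZl 0 0 x; rewrite !scale0r. Qed.

Lemma numulr0 x : x ** 0 = 0.
Proof. by have := numulZr 0 x 0; rewrite !scale0r. Qed.

Lemma numulNr x y : (- x) ** y = - (x ** y).
Proof. by rewrite -scaleN1r numulZl scaleN1r. Qed.

Lemma numulrN x y : x ** (- y) = - (x ** y).
Proof. by rewrite -scaleN1r numulZr scaleN1r. Qed.

Lemma left_ideal_preim S x : is_left_ideal S ->
  is_left_ideal [set w | S (w ** x)].
Proof.
move=> [[S0 h] mS]; split=> [|y z /=]; last by rewrite -numulA; apply: mS.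
split=> /= [|c y z]; first by rewrite numul0r.
by rewrite numulDl numulZl; apply: h.
Qed.

Lemma left_ideal_rmul S x : is_left_ideal S ->
  is_left_ideal [set z | exists2 w, S w & z = w ** x].
Proof.
move=> [[S0 h] mS]; split; last first.
  by move=> y _ [z Sz ->]; exists (y ** z); [apply: mS|rewrite numulA].
split; first by exists 0; rewrite ?numul0r.
move=> c _ _ [y Sy ->] [z Sz ->]; exists (c *: y + z); first exact: h.
by rewrite numulDl numulZl.
Qed.

Lemma left_idealT : is_left_ideal [set: A].
Proof. by split; first split. Qed.

Lemma jradical_is_ideal : is_ideal jradical_set.
Proof.
split.
  split=> [U [[[]]]//|c x y rx ry U mU].
  by case: (mU) => -[[_ h] _] _ _ _; apply: h; [apply: rx|apply: ry].
move=> x y ry; split=> U mU; first by case: (mU) => -[_ h] _ _ _; apply: h; apply: ry.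
have [lU [e he] UnT maxU] := mU.
have [sU Umul] := lU.
have preimE S : is_left_ideal S -> [set w | U (w ** x)] `<=` S ->
    (exists2 w, S w & ~ U (w ** x)) -> S = setT.
  move=> lS US [w Sw nUw]; apply/seteqP; split=> // z _.
  have [sS Smul] := lS.
  have lM := left_ideal_sum (left_ideal_rmul x lS) lU.
  case: (maxU _ lM) => [u Uu|ME|ME].
  - exists 0, u; rewrite add0r; split=> //.
    by exists 0; [case: sS|rewrite numul0r].
  - case: nUw; rewrite -ME; exists (w ** x), 0; rewrite addr0.
    by split=> //; [exists w|case: sU].
  - have : [set: A] (z ** x) by [].
    rewrite -ME => -[_ [u [[s Ss ->] Uu zE]]].
    rewrite -(subrK s z); apply: subspaceD => //; apply: US => /=.
    by rewrite numulDl numulNr zE addrAC subrr add0r.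
have [allU|] := pselect (forall w, U (w ** x)); first exact: allU.
move=> /existsNP [w0 nUw0].
apply: (ry [set w | U (w ** x)]).
have lN := left_ideal_preim x lU.
split=> //; last first.
- move=> S lS US.
  have [[w Sw nUw]|h] := pselect (exists2 w, S w & ~ U (w ** x)).
    by right; apply: preimE => //; exists w.
  left; apply/seteqP; split=> // w Sw /=.
  by apply: contrapT => nUw; apply: h; exists w.
- by apply/eqP => E; apply: nUw0; have : [set: A] w0 by []; rewrite -E.
have lM := left_ideal_sum (left_ideal_rmul x left_idealT) lU.
case: (maxU _ lM) => [u Uu|ME|ME].
- by exists 0, u; rewrite add0r; split=> //; exists 0; rewrite ?numul0r.
- case: nUw0; rewrite -ME; exists (w0 ** x), 0; rewrite addr0.
  by split=> //; [exists w0|case: sU].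
- have : [set: A] e by [].
  rewrite -ME => -[_ [u [[s _ ->] Uu eE]]].
  exists (x ** s) => z /=.
  rewrite numulDl numulNr -!numulA.
  have -> : s ** x = e - u by rewrite eE addrK.
  rewrite numulA numulDr numulrN opprD opprK addrA.
  by apply: subspaceD; [|apply: he|apply: Umul].
Qed.

Definition jradical : ideal := Ideal jradical_is_ideal.

End Ideals.

Section Quotient.
Variables (k : fieldType) (A : nuAlgType k) (I : ideal A).

Definition ideal_equiv (x y : A) : bool := `[< ideal_set I (x - y) >].

Lemma ideal_equivP : equiv_class_of ideal_equiv.
Proof.
have [sI _] := idealP I.
have sym x y : ideal_equiv x y -> ideal_equiv y x.
  by move=> /asboolP h; apply/asboolP; rewrite -opprB; apply: subspaceN.
split=> [x|x y|y x z].
- by apply/asboolP; rewrite subrr; case: sI.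
- by apply/idP/idP; apply: sym.
- move=> /asboolP h1 /asboolP h2; apply/asboolP.
  by rewrite -(subrK y x) -addrA; apply: subspaceD.
Qed.

Canonical ideal_equiv_rel := EquivRelPack ideal_equivP.

Definition quot : Type := {eq_quot ideal_equiv_rel}.
HB.instance Definition _ := Choice.on quot.
HB.instance Definition _ := EqQuotient.on quot.

Definition proj (x : A) : quot := \pi_quot x.

Lemma proj_eqP x y : proj x = proj y <-> ideal_set I (x - y).
Proof.
split; first by move=> /eqmodP /asboolP.
by move=> h; apply/eqmodP/asboolP.
Qed.

Lemma projK (q : quot) : proj (repr q) = q.
Proof. exact: reprK. Qed.

Lemma repr_proj x : ideal_set I (repr (proj x) - x).
Proof. by apply/proj_eqP; rewrite projK. Qed.

Definition qzero : quot := proj 0.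
Definition qopp (q : quot) : quot := proj (- repr q).
Definition qadd (q r : quot) : quot := proj (repr q + repr r).
Definition qscale (c : k) (q : quot) : quot := proj (c *: repr q).
Definition qmul (q r : quot) : quot := proj (repr q ** repr r).

Let sI : subspace I := (idealP I).1.
Let mI x y : ideal_set I y -> ideal_set I (x ** y) /\ ideal_set I (y ** x) := (idealP I).2 x y.

Lemma qoppE x : qopp (proj x) = proj (- x).
Proof.
by apply/proj_eqP; rewrite -opprD; apply: subspaceN (repr_proj _).
Qed.

Lemma qaddE x y : qadd (proj x) (proj y) = proj (x + y).
Proof.
apply/proj_eqP; rewrite opprD addrACA.
by apply: subspaceD => //; apply: repr_proj.
Qed.

Lemma qscaleE c x : qscale c (proj x) = proj (c *: x).
Proof.
by apply/proj_eqP; rewrite -scalerBr; apply: subspaceZ (repr_proj _).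
Qed.

Lemma qmulE x y : qmul (proj x) (proj y) = proj (x ** y).
Proof.
apply/proj_eqP; rewrite -(subrKA (repr (proj x) ** y)).
rewrite -{1}numulNr -numulrN -numulDl -numulDr.
apply: subspaceD => //; first by apply: (mI _ _).1; apply: repr_proj.
by apply: (mI _ _).2; apply: repr_proj.
Qed.

Lemma quot_ind (P : quot -> Prop) : (forall x, P (proj x)) -> forall q, P q.
Proof. by move=> h q; rewrite -(projK q). Qed.

Fact qaddA : associative qadd.
Proof.
by elim/quot_ind=> x; elim/quot_ind=> y; elim/quot_ind=> z; rewrite !qaddE addrA.
Qed.
Fact qaddC : commutative qadd.
Proof. by elim/quot_ind=> x; elim/quot_ind=> y; rewrite !qaddE addrC. Qed.
Fact qadd0 : left_id qzero qadd.
Proof. by elim/quot_ind=> x; rewrite qaddE add0r. Qed.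
Fact qaddN : left_inverse qzero qopp qadd.
Proof. by elim/quot_ind=> x; rewrite qoppE qaddE addNr. Qed.

HB.instance Definition _ := GRing.isZmodule.Build quot qaddA qaddC qadd0 qaddN.

Lemma projD x y : proj (x + y) = proj x + proj y.
Proof. by rewrite -qaddE. Qed.

Fact qscaleA c d (q : quot) : qscale c (qscale d q) = qscale (c * d) q.
Proof. by elim/quot_ind: q => x; rewrite !qscaleE scalerA. Qed.
Fact qscale1 : left_id 1 qscale.
Proof. by elim/quot_ind=> x; rewrite qscaleE scale1r. Qed.
Fact qscaleDr : right_distributive qscale +%R.
Proof.
move=> c; elim/quot_ind=> x; elim/quot_ind=> y.
by rewrite -projD !qscaleE scalerDr projD.
Qed.
Fact qscaleDl (q : quot) : {morph qscale^~ q : c d / c + d}.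
Proof.
by elim/quot_ind: q => x c d; rewrite !qscaleE scalerDl projD.
Qed.

HB.instance Definition _ := GRing.Zmodule_isLmodule.Build k quot
  qscaleA qscale1 qscaleDr qscaleDl.

Lemma projZ c x : proj (c *: x) = c *: proj x.
Proof. by rewrite -qscaleE. Qed.

Fact qmulA : associative qmul.
Proof.
by elim/quot_ind=> x; elim/quot_ind=> y; elim/quot_ind=> z; rewrite !qmulE numulA.
Qed.
Fact qmulDl : left_distributive qmul +%R.
Proof.
elim/quot_ind=> x; elim/quot_ind=> y; elim/quot_ind=> z.
by rewrite -projD !qmulE numulDl projD.
Qed.
Fact qmulDr : right_distributive qmul +%R.
Proof.
elim/quot_ind=> x; elim/quot_ind=> y; elim/quot_ind=> z.
by rewrite -projD !qmulE numulDr projD.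
Qed.
Fact qmulZl c (q r : quot) : qmul (c *: q) r = c *: qmul q r.
Proof.
elim/quot_ind: q => x; elim/quot_ind: r => y.
by rewrite -projZ !qmulE numulZl projZ.
Qed.
Fact qmulZr c (q r : quot) : qmul q (c *: r) = c *: qmul q r.
Proof.
elim/quot_ind: q => x; elim/quot_ind: r => y.
by rewrite -projZ !qmulE numulZr projZ.
Qed.

HB.instance Definition _ := Lmodule_isNuAlgebra.Build k quot
  qmulA qmulDl qmulDr qmulZl qmulZr.

End Quotient.

Definition nu_isomorphic (k : fieldType) (A B : nuAlgType k) : Prop :=
  exists f : {linear A -> B}, bijective f /\ {morph f : x y / x ** y}.

Section Liftable.
Variables (k : fieldType) (A : nuAlgType k).

Definition liftable : Prop := exists B : set A,
  [/\ subalgebra B, B `&` jradical A = [set 0]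
    & forall x, exists y z, [/\ B y, jradical_set z & x = y + z]].

Definition gm_unit (I : Type) (e : I -> A) : Prop :=
  inhabited I /\ exists W : I -> I -> set A,
  [/\ direct_sum (fun ij : I * I => W ij.1 ij.2),
      forall i j l x y, W i j x -> W j l y -> W i l (x ** y),
      forall i j s t x y, j <> s -> W i j x -> W s t y -> x ** y = 0,
      forall i, W i i (e i) /\ e i <> 0
    & forall i j x, W i j x -> e i ** x = x /\ x ** e j = x].

End Liftable.

Record quiver := Quiver {
  vertex :> Type;
  arrow : vertex -> vertex -> Type
}.

Section GeneralizedPathAlgebra.
Variables (k : fieldType) (D : quiver) (Om : D -> algType k).

(* The Omega-paths a_0 x_1 a_1 ... x_n a_n from i to j, with n >= 0. Entries
   may be 0: the relations below make such paths vanish. The paths of length 0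
   provide the summand Om i of the path algebra, since the space freely spanned
   by the elements of Om i, modulo the linearity relations, is Om i. *)
Inductive opath : D -> D -> Type :=
| OPnil i (a : Om i) : opath i i
| OPcons i j l (a : Om i) (x : arrow i j) (p : opath j l) : opath i l.

Definition opath_lmul i l (a : Om i) (p : opath i l) : opath i l :=
  match p in opath i l return Om i -> opath i l with
  | OPnil _ b => fun a => OPnil (a * b)
  | OPcons _ _ _ b x q => fun a => OPcons (a * b) x q
  end a.

Fixpoint opath_cat i j l (p : opath i j) : opath j l -> opath i l :=
  match p in opath i j return opath j l -> opath i l with
  | OPnil _ a => opath_lmul a
  | OPcons _ _ _ a x p' => fun q => OPcons a x (opath_cat p' q)
  end.

(* opath_lin c p q r: the paths p, q, r coincide but for one entry, which
   is a in p, b in q and c a + b in r. *)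
Inductive opath_lin (c : k) :
  forall i j, opath i j -> opath i j -> opath i j -> Prop :=
| OLnil i (a b : Om i) :
    opath_lin c (OPnil a) (OPnil b) (OPnil (c *: a + b))
| OLhead i j l (a b : Om i) (x : arrow i j) (p : opath j l) :
    opath_lin c (OPcons a x p) (OPcons b x p) (OPcons (c *: a + b) x p)
| OLtail i j l (a : Om i) (x : arrow i j) (p q r : opath j l) :
    opath_lin c p q r ->
    opath_lin c (OPcons a x p) (OPcons a x q) (OPcons a x r).

Record tpath := TPath { src : D; tgt : D; tpath_val : opath src tgt }.

HB.instance Definition _ := gen_eqMixin tpath.
HB.instance Definition _ := gen_choiceMixin tpath.

Definition free_path : Type := {malg k[tpath]}.
HB.instance Definition _ := GRing.Lmodule.on free_path.

Definition opbasis i j (p : opath i j) : free_path := << TPath p >>.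

Definition tpath_mul (p q : tpath) : free_path :=
  match pselect (src q = tgt p) with
  | left e => opbasis (opath_cat (tpath_val p)
      (ecast i (opath i (tgt q)) e (tpath_val q)))
  | right _ => 0
  end.

Definition lin_ext (h : tpath -> free_path) (u : free_path) : free_path :=
  \sum_(p <- msupp u) u@_p *: h p.

Definition free_path_mul (u v : free_path) : free_path :=
  lin_ext (fun p => lin_ext (tpath_mul p) v) u.

Lemma lin_extEw (d : {fset tpath}) h (u : free_path) :
  (msupp u `<=` d)%fset -> lin_ext h u = \sum_(p <- d) u@_p *: h p.
Proof.
move=> le; rewrite /lin_ext [RHS](big_fsetID _ (mem (msupp u))) /=.
rewrite [X in _ = _ + X]big1_fset ?addr0 => [|p].
  apply: eq_fbigl => p; rewrite !inE /=.
  by case: (boolP (p \in msupp u)); rewrite ?andbF // => /(fsubsetP le) ->.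
by rewrite !inE => /andP[_ /mcoeff_outdom ->]; rewrite scale0r.
Qed.

Lemma lin_extP h (c : k) u v :
  lin_ext h (c *: u + v) = c *: lin_ext h u + lin_ext h v.
Proof.
pose d := (msupp u `|` msupp v `|` msupp (c *: u + v))%fset.
rewrite !(@lin_extEw d); last first.
- exact: fsubsetUr.
- by rewrite /d -fsetUA fsubsetUl.
- by rewrite /d -fsetUA fsetUCA fsubsetUl.
rewrite scaler_sumr -big_split /=; apply: eq_bigr => p _.
by rewrite mcoeffD mcoeffZ scalerDl scalerA.
Qed.

Lemma lin_extU h p : lin_ext h << p >> = h p.
Proof. by rewrite /lin_ext msuppU oner_eq0 big_seq_fset1 mcoeffUU scale1r. Qed.


HB.instance Definition _ h := GRing.isLinear.Build k free_path free_path _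
  (lin_ext h) (fun c u v => lin_extP h c u v).

Lemma free_path_mulZl c u v :
  free_path_mul (c *: u) v = c *: free_path_mul u v.
Proof. exact: linearZ. Qed.

Lemma free_path_mulDl : left_distributive free_path_mul +%R.
Proof. by move=> u v w; rewrite /free_path_mul linearD. Qed.

Lemma free_path_mulZr c u v :
  free_path_mul u (c *: v) = c *: free_path_mul u v.
Proof.
rewrite /free_path_mul /lin_ext scaler_sumr; apply: eq_bigr => p _.
by rewrite -!/(lin_ext _ _) linearZ !scalerA mulrC.
Qed.

Lemma free_path_mulDr : right_distributive free_path_mul +%R.
Proof.
move=> u v w; rewrite /free_path_mul /lin_ext -big_split; apply: eq_bigr => p _.
by rewrite -!/(lin_ext _ _) linearD scalerDr.
Qed.

Lemma free_path_ind (P : free_path -> Prop) :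
  P 0 -> (forall c u v, P u -> P v -> P (c *: u + v)) ->
  (forall i j (p : opath i j), P (opbasis p)) -> forall u, P u.
Proof.
move=> P0 PD PU u; rewrite (monalgE u).
elim/big_rec: _ => // -[i j p] v _ Pv.
suff -> : << u@_(TPath p) *g TPath p >> = u@_(TPath p) *: opbasis p.
  by apply: PD.
by apply/malgP => q; rewrite mcoeffZ !mcoeffU mulr_natr.
Qed.

Lemma free_path_mulU p q : free_path_mul << p >> << q >> = tpath_mul p q.
Proof. by rewrite /free_path_mul !lin_extU. Qed.

Lemma opbasis_mul i j l (p : opath i j) (q : opath j l) :
  free_path_mul (opbasis p) (opbasis q) = opbasis (opath_cat p q).
Proof.
rewrite free_path_mulU /tpath_mul /=; case: pselect => // e.
by rewrite (Prop_irrelevance e erefl).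
Qed.

Lemma opbasis_mul0 i j s t (p : opath i j) (q : opath s t) :
  s <> j -> free_path_mul (opbasis p) (opbasis q) = 0.
Proof. by move=> ne; rewrite free_path_mulU /tpath_mul /=; case: pselect. Qed.

Lemma opath_lmulA i l (a b : Om i) (p : opath i l) :
  opath_lmul a (opath_lmul b p) = opath_lmul (a * b) p.
Proof. by case: p a b => [? c|? ? ? c x p] a b /=; rewrite mulrA. Qed.

Lemma opath_cat_lmul i j l (a : Om i) (p : opath i j) (q : opath j l) :
  opath_cat (opath_lmul a p) q = opath_lmul a (opath_cat p q).
Proof. by case: p a q => [? c|? ? ? c x p] a q /=; rewrite ?opath_lmulA. Qed.

Lemma opath_catA i j l m (p : opath i j) (q : opath j l) (r : opath l m) :
  opath_cat p (opath_cat q r) = opath_cat (opath_cat p q) r.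
Proof.
elim: p q => [? a|? ? ? a x p IH] q /=; first by rewrite opath_cat_lmul.
by rewrite IH.
Qed.

Lemma free_path_mul0l v : free_path_mul 0 v = 0.
Proof. by rewrite -(scale0r (0 : free_path)) free_path_mulZl !scale0r. Qed.

Lemma free_path_mul0r v : free_path_mul v 0 = 0.
Proof. by rewrite -(scale0r (0 : free_path)) free_path_mulZr !scale0r. Qed.

Lemma free_path_mulA : associative free_path_mul.
Proof.
move=> u v w; elim/free_path_ind: u => [|c u u' IH IH'|i j p].
- by rewrite !free_path_mul0l.
- by rewrite !free_path_mulDl !free_path_mulZl IH IH'.
elim/free_path_ind: v => [|c v v' IH IH'|i' j' q].
- by rewrite free_path_mul0l !free_path_mul0r free_path_mul0l.
- by rewrite !(free_path_mulDl, free_path_mulZl, free_path_mulDr,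
    free_path_mulZr) IH IH'.
elim/free_path_ind: w => [|c w w' IH IH'|i'' j'' r].
- by rewrite !free_path_mul0r.
- by rewrite !(free_path_mulDr, free_path_mulZr) IH IH'.
have [E|ne] := pselect (i' = j); last first.
  rewrite (opbasis_mul0 p q ne) free_path_mul0l.
  have [E'|ne'] := pselect (i'' = j').
    by case: _ / E' q => q; rewrite opbasis_mul opbasis_mul0.
  by rewrite (opbasis_mul0 q r ne') free_path_mul0r.
case: _ / E p => p.
rewrite opbasis_mul; have [E'|ne'] := pselect (i'' = j').
  by case: _ / E' q => q; rewrite !opbasis_mul opath_catA.
by rewrite !opbasis_mul0 ?free_path_mul0r.
Qed.

HB.instance Definition _ := Lmodule_isNuAlgebra.Build k free_path
  free_path_mulA free_path_mulDl free_path_mulDr free_path_mulZl free_path_mulZr.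

Definition multilinear_relations : set free_path :=
  lspan [set u | exists c i j (p q r : opath i j),
    opath_lin c p q r /\ u = opbasis r - (c *: opbasis p + opbasis q)].

Lemma opath_lin_catl c i j l (p q r : opath i j) (s : opath j l) :
  opath_lin c p q r ->
  opath_lin c (opath_cat p s) (opath_cat q s) (opath_cat r s).
Proof.
move=> lin; elim: lin s => /= {i j p q r}.
- move=> i a b s; case: s a b => [i' d|i' j' l' d x s] a b /=;
    rewrite mulrDl -scalerAl; constructor.
- by move=> i j l' a b x p s; constructor.
- by move=> i j l' a x p q r _ IH s; constructor.
Qed.

Lemma opath_lin_lmul c i j (a : Om i) (p q r : opath i j) :
  opath_lin c p q r ->
  opath_lin c (opath_lmul a p) (opath_lmul a q) (opath_lmul a r).
Proof.
move=> lin; case: lin a => /= {i j p q r}.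
- by move=> i b d a; rewrite mulrDr -scalerAr; constructor.
- by move=> i j l' b d x p a; rewrite mulrDr -scalerAr; constructor.
- by move=> i j l' b x p q r lin a; constructor.
Qed.

Lemma opath_lin_catr c i j l (s : opath i j) (p q r : opath j l) :
  opath_lin c p q r ->
  opath_lin c (opath_cat s p) (opath_cat s q) (opath_cat s r).
Proof.
elim: s p q r => [i' a|i' j' l' a x s IH] p q r lin /=.
  exact: opath_lin_lmul.
by constructor; apply: IH.
Qed.

Lemma subspace_preim_mull (u : free_path) (U : set free_path) :
  subspace U -> subspace [set v | U (u ** v)].
Proof.
move=> [U0 h]; split=> /= [|c x y]; first by rewrite numulr0.
by rewrite numulDr numulZr; apply: h.
Qed.

Lemma subspace_preim_mulr (u : free_path) (U : set free_path) :
  subspace U -> subspace [set v | U (v ** u)].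
Proof.
move=> [U0 h]; split=> /= [|c x y]; first by rewrite numul0r.
by rewrite numulDl numulZl; apply: h.
Qed.

Lemma multilinear_relations_ideal : is_ideal multilinear_relations.
Proof.
have sN : subspace multilinear_relations by apply: subspace_lspan.
split=> // u v Nv; elim/free_path_ind: u => [|c u u' [IHl IHr] [IHl' IHr']|i j s].
- by rewrite numul0r numulr0; case: sN.
- rewrite numulDl numulDr numulZl numulZr.
  by case: sN => _ h; split; apply: h.
split.
  apply: (Nv [set v | multilinear_relations (opbasis s ** v)]).
  split; first exact: subspace_preim_mull.
  move=> _ /= [c [i' [j' [p [q [r [lin ->]]]]]]].
  rewrite numulDr numulrN numulDr numulZr.
  have [E|ne] := pselect (i' = j); last first.
    rewrite [_ ** opbasis r]opbasis_mul0 // [_ ** opbasis p]opbasis_mul0 //.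
    rewrite [_ ** opbasis q]opbasis_mul0 // scaler0 addr0 subr0.
    by case: sN.
  case: _ / E s => s.
  rewrite [_ ** opbasis r]opbasis_mul [_ ** opbasis p]opbasis_mul [_ ** opbasis q]opbasis_mul.
  apply: sub_gen_smallest; exists c, i, j'; do 3!eexists; split; last by [].
  exact: opath_lin_catr.
apply: (Nv [set v | multilinear_relations (v ** opbasis s)]).
split; first exact: subspace_preim_mulr.
move=> _ /= [c [i' [j' [p [q [r [lin ->]]]]]]].
rewrite numulDl numulNr numulDl numulZl.
have [E|ne] := pselect (i = j'); last first.
  rewrite [opbasis r ** _]opbasis_mul0 // [opbasis p ** _]opbasis_mul0 //.
  rewrite [opbasis q ** _]opbasis_mul0 // scaler0 addr0 subr0.
  by case: sN.
case: _ / E p q r lin => p q r lin.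
rewrite [opbasis r ** _]opbasis_mul [opbasis p ** _]opbasis_mul [opbasis q ** _]opbasis_mul.
apply: sub_gen_smallest; exists c, i', j; do 3!eexists; split; last by [].
exact: opath_lin_catl.
Qed.

Definition gpalg : nuAlgType k := quot (Ideal multilinear_relations_ideal).

Definition gpath i j (p : opath i j) : gpalg :=
  proj (Ideal multilinear_relations_ideal) (opbasis p).

(* The arrow x, identified with e_ii x e_jj. *)
Definition garrow i j (x : arrow i j) : gpalg :=
  gpath (OPcons 1 x (OPnil 1)).

Definition arrow_ideal : ideal gpalg :=
  gideal [set u | exists i j (x : arrow i j), u = garrow x].

Definition weak_relations (rho : set gpalg) : Prop :=
  (exists t, (0 < t)%N /\ idealX arrow_ideal t `<=` gideal rho) /\
  gideal rho `<=` arrow_ideal.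

End GeneralizedPathAlgebra.

(* Main.v *)
Require Import Defs.
From HB Require Import structures.
From mathcomp Require Import all_boot all_algebra.
From mathcomp Require Import boolp classical_sets.
From mathcomp Require Import finmap.
From mathcomp.multinomials Require Import monalg.


(** Let [r] be the radical of [L].

    From weak relations to a liftable algebra.  Let [f] be a surjection from the
    path algebra onto [L] whose kernel lies between a power of the arrow ideal
    [J] and [J].  Then [r] is [f(J)] ([jradical_image]).  On the one hand [f(J)]
    is a nilpotent ideal, and nil left ideals lie in the radical.  On the other
    hand the projections of the path algebra onto the vertex algebras kill [J],
    so that they factor through [L]; surjections map radicals into radicals,
    the vertex algebras have none, and an element of the span of the vertex
    algebras with all projections zero is zero.  The image of that span is thus
    a complement of [r], and the images of the unities of the vertex algebras
    are the gm unit; they commute with the complement.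

    From a liftable algebra to weak relations.  Let [B] be a subalgebra
    complementing [r] and [(e_i)] the gm unit.  The element [b_i] of [B]
    congruent to [e_i] modulo [r] is idempotent and central in [B], because
    [B] is isomorphic to [L / r].  The delicate point is that the [b_i] still
    decompose [L], even when the index set is infinite: since
    [e_i x e_j - b_i e_i x e_j b_j] lies one power of [r] deeper than [x],
    descending induction on the powers of [r] shows that [L] is the sum of the
    [b_i L b_j] ([lift_idempotents]).  Now take [b_i B] as the algebra at the
    vertex [i], whose radical vanishes ([corner_jradical]), and all of
    [b_i r b_j] as arrows from [i] to [j].  The universal property of the path
    algebra gives a surjection onto [L].  It maps [J] into [r], whence a power
    of [J] lies in its kernel; and it is injective on the span of the vertex
    algebras, which it maps to [B], whence its kernel lies in [J].  The kernel
    itself is the set of relations.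

    A gm unit is handled as a family of non-zero orthogonal idempotents such
    that the [e_i L e_j] span [L] ([gm_unitP]).  Each element
    has a two-sided unit in the span of the idempotents ([local_unit]), which
    makes up for the unity element that [L] may lack. *)

Set Implicit Arguments.
Unset Strict Implicit.
Unset Printing Implicit Defensive.

Import GRing.Theory.

Local Open Scope ring_scope.
Local Open Scope classical_set_scope.

(** * Spans, morphisms and powers of ideals *)

Section Spans.
Variables (k : fieldType) (V : lmodType k).
Implicit Types (S U : set V).

Lemma lspan_sub S U : subspace U -> S `<=` U -> lspan S `<=` U.
Proof. by move=> sU SU x; apply. Qed.

Lemma sub_lspan S : S `<=` lspan S.
Proof. exact: sub_gen_smallest. Qed.

Lemma subspace_set1 : subspace [set (0 : V)].
Proof. by split=> // c x y -> ->; rewrite scaler0 addr0. Qed.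

Lemma subspace_preim (W : lmodType k) (f : {linear W -> V}) U :
  subspace U -> subspace [set x | U (f x)].
Proof.
by move=> [U0 h]; split=> /= [|c x y]; rewrite ?linear0 // linearP; apply: h.
Qed.

Lemma subspace_image (W : lmodType k) (f : {linear V -> W}) U :
  subspace U -> subspace (f @` U).
Proof.
move=> [U0 h]; split=> [|c _ _ [x Ux <-] [y Uy <-]].
  by exists 0; rewrite ?linear0.
by exists (c *: x + y); [exact: h | rewrite linearP].
Qed.

(** The finite sums of the definition of a direct sum form a subspace, by
    concatenation of the families. *)
Lemma lspan_finite_sum (T : Type) (W : T -> set V) x :
  (forall t, subspace (W t)) -> lspan [set y | exists t, W t y] x ->
  exists n (t : 'I_n -> T) (v : 'I_n -> V),
    (forall m, W (t m) (v m)) /\ x = \sum_m v m.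
Proof.
move=> sW; move: x; apply: lspan_sub => [|x [t Wx]]; last first.
  by exists 1%N, (fun=> t), (fun=> x); rewrite big_ord1.
split=> [|c x y [n [t [v [Wv ->]]]] [n' [t' [v' [Wv' ->]]]]].
  exists 0%N, (fun m : 'I_0 => False_rect T (notF (ltn_ord m))), (fun=> 0).
  by split=> [[]//|]; rewrite big_ord0.
exists (n + n')%N,
  (fun m => match split m with inl a => t a | inr b => t' b end),
  (fun m => match split m with inl a => c *: v a | inr b => v' b end).
split=> [m|]; first by case: (split m) => a //; apply: subspaceZ.
rewrite big_split_ord scaler_sumr; congr (_ + _); apply: eq_bigr => m _.
  by rewrite (unsplitK (inl m)).
by rewrite (unsplitK (inr m)).
Qed.

End Spans.

Section Powers.
Variable k : fieldType.
Implicit Types A B : nuAlgType k.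

Lemma idealXS A (U : set A) n x y :
  U x -> idealX U n.+1 y -> idealX U n.+2 (x ** y).
Proof. by move=> Ux Uy; apply: sub_lspan; exists x, y. Qed.

Lemma subspace_mull A (u : A) U : subspace U -> subspace [set v | U (u ** v)].
Proof.
move=> [U0 h]; split=> /= [|c x y]; first by rewrite numulr0.
by rewrite numulDr numulZr; apply: h.
Qed.

Lemma subspace_mulr A (u : A) U : subspace U -> subspace [set v | U (v ** u)].
Proof.
move=> [U0 h]; split=> /= [|c x y]; first by rewrite numul0r.
by rewrite numulDl numulZl; apply: h.
Qed.

Lemma idealXSr A (U : set A) n x y :
  idealX U n.+1 x -> U y -> idealX U n.+2 (x ** y).
Proof.
move=> + Uy; elim: n x => [|n IH]; first by move=> x Ux; apply: idealXS.
apply: lspan_sub; first exact/subspace_mulr/subspace_lspan.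
move=> _ [a [c [Ua Uc ->]]] /=; rewrite -numulA.
by apply: idealXS => //; apply: IH.
Qed.

Lemma idealX_ideal A (U : set A) n : is_ideal U -> is_ideal (idealX U n).
Proof.
move=> iU; case: n => [|n] //; elim: n => [|n [sX iX]] //.
split=> [|x]; first exact: subspace_lspan.
have [sU mU] := iU.
suff h : forall y, idealX U n.+2 y ->
    [set y | idealX U n.+2 (x ** y) /\ idealX U n.+2 (y ** x)] y by [].
apply: lspan_sub => [|_ [a [c [Ua Uc ->]]] /=].
  have sX2 : subspace (idealX U n.+2) by apply: subspace_lspan.
  have [? hl] := subspace_mull x sX2; have [? hr] := subspace_mulr x sX2.
  by split=> // d y z [? ?] [? ?]; split; [apply: hl | apply: hr].
rewrite numulA -[_ ** _ ** x]numulA; split; apply: idealXS => //.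
  by apply: (mU _ _ _).1.
by apply: (iX _ _ _).2.
Qed.

Lemma idealX_morph A B (f : {linear A -> B}) (U : set A) (S : set B) n :
  {morph f : x y / x ** y} -> (forall x, U x -> S (f x)) ->
  forall x, idealX U n x -> idealX S n (f x).
Proof.
move=> fM fU; case: n => [|n] //; elim: n => [|n IH] //.
apply: lspan_sub; first exact/subspace_preim/subspace_lspan.
move=> _ [x [y [Ux Xy ->]]] /=; rewrite fM.
by apply: idealXS; [apply: fU | apply: IH].
Qed.

Lemma idealX_image A B (f : {linear A -> B}) (U : set A) n :
  {morph f : x y / x ** y} -> idealX (f @` U) n `<=` f @` idealX U n.
Proof.
move=> fM; case: n => [|n] //; elim: n => [|n IH] //.
apply: lspan_sub; first exact/subspace_image/subspace_lspan.
move=> _ [_ [z [[x Ux <-] /IH [y Xy <-] ->]]].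
by exists (x ** y); [apply: idealXS | rewrite fM].
Qed.

Lemma idealX_exp A (U : set A) x n : U x -> idealX U n.+1 (iter n (numul x) x).
Proof. by move=> Ux; elim: n => [|n IH] //; apply: idealXS. Qed.

Lemma nilpotent_exp A (U : set A) x : nilpotent U -> U x ->
  exists n, iter n (numul x) x = 0.
Proof.
by move=> [[|n] [//]] _ U0 Ux; exists n; apply: U0; apply: idealX_exp.
Qed.

Lemma nilpotent_idempotent A (U : set A) x : nilpotent U -> U x ->
  x ** x = x -> x = 0.
Proof.
by move=> nU Ux xx; have [n] := nilpotent_exp nU Ux; rewrite iter_fix.
Qed.

Lemma is_ideal_preim A B (f : {linear A -> B}) (U : set B) :
  {morph f : x y / x ** y} -> is_ideal U -> is_ideal [set x | U (f x)].
Proof.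
move=> fM [sU mU]; split=> [|x y Uy /=]; first exact: subspace_preim.
by rewrite !fM; apply: mU.
Qed.

Lemma is_ideal_ker A B (f : {linear A -> B}) :
  {morph f : x y / x ** y} -> is_ideal [set x | f x = 0].
Proof.
move=> fM; apply: (is_ideal_preim fM (U := [set 0])).
split=> [|u v /= ->]; first exact: subspace_set1.
by rewrite numulr0 numul0r.
Qed.

Lemma gideal_sub A (S U : set A) : is_ideal U -> S `<=` U -> gideal S `<=` U.
Proof. by move=> iU SU x; apply. Qed.

Lemma sub_gideal A (S : set A) : S `<=` gideal S.
Proof. exact: sub_gen_smallest. Qed.

(** First isomorphism theorem, with the inverse isomorphism induced by a section
    of [f]. *)
Lemma nu_isomorphic_quot A B (f : {linear A -> B}) (U : ideal A) :
  {morph f : x y / x ** y} -> (forall y, exists x, f x = y) ->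
  (forall x, ideal_set U x <-> f x = 0) -> nu_isomorphic B (quot U).
Proof.
move=> fM /choice [s fs] kerf.
have pE x y : f x = f y -> proj U x = proj U y.
  by move=> E; apply/proj_eqP/kerf; rewrite linearB E subrr.
have lin c x y : proj U (s (c *: x + y)) = c *: proj U (s x) + proj U (s y).
  by rewrite -projZ -projD; apply: pE; rewrite linearP !fs.
pose g := HB.pack_for {linear B -> quot U} (proj U \o s)
  (GRing.isLinear.Build k B (quot U) _ (proj U \o s) lin).
exists g; split.
  exists (f \o repr) => [y|q] /=.
    apply/eqP; rewrite -{2}(fs y) -subr_eq0 -linearB; apply/eqP/kerf.
    exact: repr_proj.
  by rewrite -[RHS]projK; apply: pE; rewrite fs.
move=> x y /=.
have -> : proj U (s x) ** proj U (s y) = proj U (s x ** s y) by apply: qmulE.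
by apply: pE; rewrite fM !fs.
Qed.

(** Conversely, an isomorphism with a quotient yields a surjection with the
    prescribed kernel, so that the quotient itself can be left aside. *)
Lemma nu_isomorphic_quotE A B (U : ideal A) : nu_isomorphic B (quot U) ->
  exists f : {linear A -> B}, [/\ {morph f : x y / x ** y},
    forall y, exists x, f x = y & forall x, ideal_set U x <-> f x = 0].
Proof.
move=> [g [[h gK hK] gM]].
have gI := can_inj gK.
have lin c x y : h (proj U (c *: x + y)) = c *: h (proj U x) + h (proj U y).
  by apply: gI; rewrite linearP !hK projD projZ.
pose f := HB.pack_for {linear A -> B} (h \o proj U)
  (GRing.isLinear.Build k A B _ (h \o proj U) lin).
exists f; split=> [x y|y|x] /=.
- by apply: gI; rewrite gM !hK; apply/esym/qmulE.
- by exists (repr (g y)); rewrite projK.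
- split=> [Ux|E].
    apply: gI; rewrite hK linear0; apply/proj_eqP; by rewrite subr0.
  rewrite -[x]subr0; apply/proj_eqP; rewrite -/(proj U 0) -[LHS]hK E linear0.
  by [].
Qed.

End Powers.

(** * The Jacobson radical *)

Section Radical.
Variable k : fieldType.
Implicit Types A B : nuAlgType k.

(** A nil left ideal not contained in a maximal modular left ideal [U] contains
    some [n] congruent modulo [U] to the right unit [e] of [U]; then [x] is
    congruent to [x n], hence to [x n^m = 0], for all [x]. *)
Lemma nil_sub_jradical A (N : set A) : is_left_ideal N ->
  (forall x, N x -> exists m, iter m (numul x) x = 0) -> 
  N `<=` jradical_set (A:=A).
Proof.
move=> lN nilN x0 Nx0 U [lU [e he] UnT maxU]; apply: contrapT => nUx0.
have [[N0 _] _] := lN; have [sU mU] := lU; have [U0 _] := sU.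
case: (maxU _ (left_ideal_sum lN lU)) => [u Uu|E|E].
- by exists 0, u; rewrite add0r.
- by apply: nUx0; rewrite -E; exists x0, 0; rewrite addr0.
have : [set: A] e by [].
rewrite -E => -[n [u [Nn Uu eE]]].
have cong x : U (x - x ** n).
  have -> : x - x ** n = (x - x ** e) + x ** u.
    by rewrite eE numulDr opprD addrA addrNK.
  by apply: subspaceD => //; apply: mU.
have congX m x : U (x - x ** iter m (numul n) n).
  elim: m x => [|m IH] x /=; first exact: cong.
  rewrite -(subrKA (x ** n)) numulA.
  by apply: subspaceD.
have [m nm0] := nilN n Nn.
apply: nUx0; have := congX m x0.
by rewrite nm0 numulr0 subr0.
Qed.

(** The preimage of a maximal modular left ideal under a surjection is maximal
    modular. *)
Lemma jradical_surj A B (f : {linear A -> B}) : {morph f : x y / x ** y} ->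
  (forall y, exists x, f x = y) ->
  forall x, jradical_set x -> jradical_set (f x).
Proof.
move=> fM fS x rx U [lU [e he] UnT maxU].
have [sU mU] := lU.
apply: (rx [set z | U (f z)]); split.
- split=> [|y z Uz /=]; first exact: subspace_preim.
  by rewrite fM; apply: mU.
- have [e' fe'] := fS e; exists e' => z /=.
  by rewrite linearB fM fe'.
- apply/eqP => E; move/eqP: UnT; apply; apply/seteqP; split=> // y _.
  have [z <-] := fS y; have : [set: A] z by [].
  by rewrite -E.
move=> S [sS mS] US.
have lfS : is_left_ideal (f @` S).
  split=> [|y _ [z Sz <-]]; first exact: subspace_image.
  by have [y' <-] := fS y; exists (y' ** z); [apply: mS | rewrite fM].
have satS z : (f @` S) (f z) -> S z.
  move=> [s Ss E]; rewrite -(subrK s z); apply: subspaceD => //.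
  by apply: US; rewrite /= linearB E subrr; case: sU.
case: (maxU _ lfS) => [y Uy|E|E].
- by have [z E] := fS y; exists z => //; apply: US; rewrite /= E.
- left; apply/seteqP; split=> // z Sz /=; rewrite -E; by exists z.
- right; apply/seteqP; split=> // z _; apply: satS; rewrite E; by [].
Qed.

End Radical.

(** * Orthogonal idempotents *)

Section Peirce.
Variables (k : fieldType) (A : nuAlgType k).

(** The orthogonality makes the sum of the components [e_i A e_j] direct. *)
Definition peirce_system (I : Type) (e : I -> A) : Prop :=
  [/\ forall i, e i ** e i = e i,
      forall i j, i <> j -> e i ** e j = 0
    & forall x, lspan [set y | exists i j, e i ** y = y /\ y ** e j = y] x].

Section System.
Variables (I : Type) (e : I -> A).
Hypothesis eP : peirce_system e.

(** Elements of the span of the idempotents commute, so that [u + v - u v] fixes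
    whatever [u] or [v] fixes, on either side. *)
Lemma local_unit x :
  exists2 u, lspan (range e) u & u ** x = x /\ x ** u = x.
Proof.
have [e_id e0 span_e] := eP.
pose P := lspan (range e); have sP : subspace P by apply: subspace_lspan.
have eC i j : e i ** e j = e j ** e i.
  by have [->|ne] := pselect (i = j) => //; rewrite !e0 // => E; apply: ne.
have uC u v : P u -> P v -> u ** v = v ** u.
  move=> Pu Pv; move: u Pu; apply: lspan_sub => [|_ [i _ <-]] /=.
    split=> /= [|c x' y' E E']; first by rewrite numul0r numulr0.
    by rewrite numulDl numulDr numulZl numulZr E E'.
  move: v Pv; apply: lspan_sub => [|_ [j _ <-]] //=.
  split=> /= [|c x' y' E E']; first by rewrite numul0r numulr0.
  by rewrite numulDl numulDr numulZl numulZr E E'.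
have uM u v : P u -> P v -> P (u ** v).
  move=> Pu Pv; move: u Pu; apply: lspan_sub => [|_ [i _ <-]] /=.
    exact: subspace_mulr.
  move: v Pv; apply: lspan_sub => [|_ [j _ <-]] /=; first exact: subspace_mull.
  have [->|ne] := pselect (i = j); last by rewrite e0 //; case: sP.
  by rewrite e_id; apply: sub_lspan; exists j.
have join u v : P u -> P v -> exists2 w, P w &
    forall y, (u ** y = y \/ v ** y = y -> w ** y = y) /\
              (y ** u = y \/ y ** v = y -> y ** w = y).
  move=> Pu Pv; exists (u + v - u ** v).
    by apply: (subspaceB sP); [apply: (subspaceD sP) | apply: uM].
  move=> y; split=> -[E|E].
  - by rewrite (uC u v) // numulDl numulNr numulDl -numulA E addrK.
  - by rewrite numulDl numulNr numulDl -numulA E [_ + y]addrC addrK.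
  - by rewrite numulDr numulrN numulDr numulA E addrK.
  - by rewrite (uC u v) // numulDr numulrN numulDr numulA E [_ + y]addrC addrK.
move: x (span_e x); apply: lspan_sub => [|x [i [j [ex xe]]]]; last first.
  have Pe l : P (e l) by apply: sub_lspan; exists l.
  by have [w Pw /(_ x) [wx xw]] := join _ _ (Pe i) (Pe j); exists w; auto.
split=> [|c x y [u Pu [ux xu]] [v Pv [vy yv]]].
  by exists 0; [case: sP | rewrite numulr0].
have [w Pw wP] := join _ _ Pu Pv; exists w => //.
have [[wx xw] [wy yw]] := (wP x, wP y).
by rewrite numulDr numulDl numulZr numulZl wx ?wy ?xw ?yw; auto.
Qed.

(** A local unit of [x] is a combination of the idempotents. *)
Lemma peirce_eq0 x : (forall i, e i ** x = 0) -> x = 0.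
Proof.
move=> ex0; have [u Pu [<- _]] := local_unit x.
move: u Pu; apply: (@lspan_sub _ _ _ [set u | u ** x = 0]).
  exact: (subspace_mulr x (@subspace_set1 _ A)).
by move=> _ [i _ <-]; apply: ex0.
Qed.

End System.

(** The component of index [(i, j)] of the direct sum is necessarily
    [e_i A e_j], whose elements are those fixed by [e_i] on the left and by
    [e_j] on the right. *)
Lemma gm_unitP (I : Type) (e : I -> A) :
  gm_unit e <-> [/\ inhabited I, peirce_system e & forall i, e i <> 0].
Proof.
split=> [[iI [W [[sW spanW freeW] mulW mulW0 eW unitW]]]|[iI eP e_neq0]].
  split=> // [|i]; last by case: (eW i).
  split=> [i|i j ne|x].
  - by have [Wi _] := eW i; have [] := unitW _ _ _ Wi.
  - by apply: (mulW0 i i j j) => //; have [] := eW i; have [] := eW j.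
  have [n [t [v [Wv ->]]]] := spanW x.
  have sS : subspace (lspan [set y | exists i j, e i ** y = y /\ y ** e j = y]).
    exact: subspace_lspan.
  elim/big_ind: _ => [|y z|m _]; [by case: sS|exact: subspaceD|].
  by apply: sub_lspan; exists (t m).1, (t m).2; apply: unitW.
split=> //; exists (fun i j => [set x | e i ** x = x /\ x ** e j = x]).
have [e_id e0 span_e] := eP.
have sW i j : subspace [set x | e i ** x = x /\ x ** e j = x].
  split=> /= [|c x y [h1 h2] [h3 h4]]; first by rewrite numul0r numulr0.
  by rewrite numulDl numulDr numulZl numulZr h1 h2 h3 h4.
split=> [|i j l x y [ex _] [_ ye]|i j s t x y ne [_ xe] [ey _]|i|//].
- split=> [[i j]|x|n t v tI Wv v0 m]; first exact: sW.
    apply: (@lspan_finite_sum _ _ _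
      (fun ij : I * I => [set x | e ij.1 ** x = x /\ x ** e ij.2 = x]))
      => [[i j]|]; first exact: sW.
    have := span_e x; apply: lspan_sub; first exact: subspace_lspan.
    by move=> y [i [j yP]]; apply: sub_lspan; exists (i, j).
  have sK : subspace [set z | e (t m).1 ** z ** e (t m).2 = 0].
    exact: (subspace_mull _ (subspace_mulr _ (@subspace_set1 _ A))).
  have [ev ve] := Wv m; rewrite -{1}ve -{1}ev.
  move: v0; rewrite (bigD1 m) //= => /eqP; rewrite addr_eq0 => /eqP ->.
  suff : [set z | e (t m).1 ** z ** e (t m).2 = 0] (\sum_(i < n | i != m) v i).
    by move=> /(subspaceN sK).
  elim/big_ind: _ => [|y z|m' ne]; [by case: sK|exact: subspaceD|].
  have [ev' ve'] := Wv m'; rewrite /=.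
  have [E1|ne1] := pselect ((t m).1 = (t m').1); last first.
    by rewrite -ev' numulA e0 // !numul0r.
  have [E2|ne2] := pselect ((t m').2 = (t m).2); last first.
    by rewrite -ve' -!numulA e0 // !numulr0.
  case/eqP: ne; apply: tI; move: E1 E2.
  by case: (t m) (t m') => [? ?] [? ?] /= -> ->.
- by rewrite /= numulA ex -numulA ye.
- by rewrite -xe -ey -numulA [e j ** _]numulA e0 // numul0r numulr0.
- by split; [rewrite /= e_id | apply: e_neq0].
Qed.

End Peirce.

Lemma peirce_surj (k : fieldType) (A B : nuAlgType k) (f : {linear A -> B})
    (I : Type) (e : I -> A) :
  {morph f : x y / x ** y} -> (forall y, exists x, f x = y) ->
  peirce_system e -> peirce_system (f \o e).
Proof.
move=> fM fS [e_id e0 span_e].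
split=> [i|i j ne|y] /=; first by rewrite -fM e_id.
  by rewrite -fM e0 // linear0.
have [x <-] := fS y; move: x (span_e x).
apply: lspan_sub; first exact/subspace_preim/subspace_lspan.
move=> x [i [j [ex xe]]]; apply: sub_lspan; exists i, j.
by rewrite /= -!fM ex xe.
Qed.

(** * The generalized path algebra *)

Section PathAlgebra.
Variables (k : fieldType) (D : quiver) (Om : D -> algType k).
Local Notation R := (gpalg Om).

Lemma gpath_lin c i j (p q r : opath Om i j) :
  opath_lin c p q r -> gpath r = c *: gpath p + gpath q.
Proof.
move=> lin; rewrite /gpath -projZ -projD; apply/proj_eqP.
by apply: sub_lspan; exists c, i, j, p, q, r.
Qed.

Lemma gpath_mul i j l (p : opath Om i j) (q : opath Om j l) :
  gpath p ** gpath q = gpath (opath_cat p q).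
Proof.
rewrite /gpath -opbasis_mul; exact: qmulE.
Qed.

Lemma gpath_mul0 i j s t (p : opath Om i j) (q : opath Om s t) :
  j <> s -> gpath p ** gpath q = 0.
Proof.
move=> ne; rewrite /gpath; apply: (etrans (qmulE _ _ _)).
by rewrite [_ ** _]opbasis_mul0 // => E; apply: ne.
Qed.

Lemma gpalg_ind (U : set R) : subspace U ->
  (forall i j (p : opath Om i j), U (gpath p)) -> forall x, U x.
Proof.
move=> [U0 sU] Up; elim/quot_ind; elim/free_path_ind=> //= c u v Uu Uv.
by rewrite projD projZ; apply: sU.
Qed.

Definition gvertex i (a : Om i) : R := gpath (OPnil a).

Fact gvertex_linear i : linear (@gvertex i).
Proof. by move=> c a b; apply/gpath_lin/OLnil. Qed.

HB.instance Definition _ i :=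
  GRing.isLinear.Build k (Om i) R _ (@gvertex i) (@gvertex_linear i).

Lemma gvertexM i (a b : Om i) : gvertex (a * b) = gvertex a ** gvertex b.
Proof. by rewrite /gvertex gpath_mul. Qed.

Lemma gvertexM0 i j (a : Om i) (b : Om j) :
  i <> j -> gvertex a ** gvertex b = 0.
Proof. exact: gpath_mul0. Qed.

Lemma gpath_cons i j l (a : Om i) (x : arrow i j) (p : opath Om j l) :
  gpath (OPcons a x p) = gvertex a ** (garrow Om x ** gpath p).
Proof.
rewrite /garrow /gvertex !gpath_mul /= mulr1; congr (gpath (OPcons _ _ _)).
by case: p {x} => *; rewrite /= mul1r.
Qed.

Lemma gvertex1l i j (p : opath Om i j) :
  gvertex (1 : Om i) ** gpath p = gpath p.
Proof.
by rewrite /gvertex gpath_mul; congr gpath; case: p => *; rewrite /= mul1r.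
Qed.

Lemma gvertex1r i j (p : opath Om i j) :
  gpath p ** gvertex (1 : Om j) = gpath p.
Proof.
rewrite /gvertex gpath_mul; congr gpath.
by elim: p => [? a|? ? ? a x p IH] /=; rewrite ?mulr1 ?IH.
Qed.

Lemma gvertex_peirce : peirce_system (fun i : D => gvertex (1 : Om i)).
Proof.
split=> [i|i j|]; first by rewrite -gvertexM mulr1.
  exact: gvertexM0.
apply: gpalg_ind => [|i j p]; first exact: subspace_lspan.
by apply: sub_lspan; exists i, j; rewrite gvertex1l gvertex1r.
Qed.

Definition vertex_span : set R :=
  lspan [set u | exists i (a : Om i), u = gvertex a].

Lemma subspace_vertex_span : subspace vertex_span.
Proof. exact: subspace_lspan. Qed.

Lemma vertex_spanM x y :
  vertex_span x -> vertex_span y -> vertex_span (x ** y).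
Proof.
move=> + Vy; move: x; apply: lspan_sub => [|_ [i [a ->]]] /=.
  exact/subspace_mulr/subspace_lspan.
move: y Vy; apply: lspan_sub => [|_ [j [b ->]]] /=.
  exact/subspace_mull/subspace_lspan.
have [E|ne] := pselect (i = j); last first.
  by rewrite gvertexM0 //; case: subspace_vertex_span.
case: _ / E b => b; rewrite -gvertexM; apply: sub_lspan.
by exists i, (a * b).
Qed.

Lemma vertex_span_central i x :
  vertex_span x -> gvertex (1 : Om i) ** x = x ** gvertex (1 : Om i).
Proof.
move: x; apply: lspan_sub => [|_ [j [a ->]]] /=.
  split=> /= [|c x y E E']; first by rewrite numul0r numulr0.
  by rewrite numulDl numulDr numulZl numulZr E E'.
have [E|ne] := pselect (i = j); last by rewrite !gvertexM0 // => E; apply: ne.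
by case: _ / E a => a; rewrite -!gvertexM mulr1 mul1r.
Qed.

Lemma garrow_sub i j (x : arrow i j) :
  ideal_set (arrow_ideal Om) (garrow Om x).
Proof. by apply: sub_gideal; exists i, j, x. Qed.

(** A path of positive length contains an arrow. *)
Lemma gpalg_decomp x : exists w j,
  [/\ vertex_span w, ideal_set (arrow_ideal Om) j & x = w + j].
Proof.
have sV := subspace_vertex_span.
have [sJ mJ] := idealP (arrow_ideal Om).
have [V0 _] := sV; have [J0 _] := sJ.
move: x; apply: gpalg_ind => [|i j p].
  split=> [|c _ _ [w [j [Vw Jj ->]]] [w' [j' [Vw' Jj' ->]]]].
    by exists 0, 0; rewrite addr0.
  exists (c *: w + w'), (c *: j + j'); rewrite scalerDr addrACA; split=> //.
    by case: sV => _; apply.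
  by case: sJ => _; apply.
case: p => {i j} [i a|i j l a x p].
  exists (gvertex a), 0; rewrite addr0; split=> //.
  by apply: sub_lspan; exists i, a.
exists 0, (gpath (OPcons a x p)); rewrite add0r; split=> //.
rewrite gpath_cons; apply: (mJ _ _ _).1; apply: (mJ _ _ _).2.
exact: garrow_sub.
Qed.

(** ** Universal property *)

Section Evaluation.
Variables (L : nuAlgType k) (phi : forall i, {linear Om i -> L}).
Variable psi : forall i j : D, arrow i j -> L.

Fixpoint opath_eval i j (p : opath Om i j) : L :=
  match p with
  | OPnil _ a => phi _ a
  | OPcons _ _ _ a x q => phi _ a ** (psi x ** opath_eval q)
  end.

Definition free_eval (u : free_path Om) : L :=
  \sum_(p <- msupp u) u@_p *: opath_eval (tpath_val p).

(** A common support for several elements makes the sums comparable. *)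
Lemma free_evalEw (d : {fset tpath Om}) (u : free_path Om) :
  (msupp u `<=` d)%fset ->
  free_eval u = \sum_(p <- d) u@_p *: opath_eval (tpath_val p).
Proof.
move=> le; apply: (big_fset_incl _ le) => p _ /mcoeff_outdom ->.
by rewrite scale0r.
Qed.

Fact free_eval_linear : linear free_eval.
Proof.
move=> c u v; pose d := (msupp u `|` msupp v `|` msupp (c *: u + v))%fset.
rewrite !(@free_evalEw d) ?fsubsetUr //; last first.
- by rewrite /d -fsetUA fsubsetUl.
- by rewrite /d -fsetUA fsetUCA fsubsetUl.
rewrite scaler_sumr -big_split /=; apply: eq_bigr => p _.
by rewrite mcoeffD mcoeffZ scalerDl scalerA.
Qed.

HB.instance Definition _ :=
  GRing.isLinear.Build k (free_path Om) L _ free_eval free_eval_linear.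

Lemma free_eval_basis i j (p : opath Om i j) :
  free_eval (opbasis p) = opath_eval p.
Proof.
by rewrite /free_eval msuppU oner_eq0 big_seq_fset1 mcoeffUU scale1r.
Qed.

Lemma opath_eval_lin c i j (p q r : opath Om i j) : opath_lin c p q r ->
  opath_eval r = c *: opath_eval p + opath_eval q.
Proof.
elim=> {i j p q r} [i a b|i j l a b x p|i j l a x p q r _ IH] /=.
- by rewrite linearP.
- by rewrite linearP numulDl numulZl.
- by rewrite IH !numulDr !numulZr.
Qed.

Lemma free_eval_relations u : multilinear_relations u -> free_eval u = 0.
Proof.
move: u; apply: (@lspan_sub _ _ _ [set u | free_eval u = 0]) => [|u].
  exact: (subspace_preim _ (@subspace_set1 _ L)).
move=> [c [i [j [p [q [r [lin ->]]]]]]] /=.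
rewrite linearB linearP /= !free_eval_basis (opath_eval_lin lin).
by rewrite subrr.
Qed.

Definition gpeval (x : R) : L := free_eval (repr x).

Lemma gpeval_proj u : gpeval (proj _ u) = free_eval u.
Proof.
apply/eqP; rewrite -subr_eq0 -linearB; apply/eqP/free_eval_relations.
exact: (@repr_proj _ _ (Ideal (multilinear_relations_ideal Om))).
Qed.

Lemma gpeval_gpath i j (p : opath Om i j) : gpeval (gpath p) = opath_eval p.
Proof. by rewrite gpeval_proj free_eval_basis. Qed.

Fact gpeval_linear : linear gpeval.
Proof.
move=> c; elim/quot_ind=> u; elim/quot_ind=> v.
by rewrite -projZ -projD !gpeval_proj linearP.
Qed.

HB.instance Definition _ :=
  GRing.isLinear.Build k R L _ gpeval gpeval_linear.

Lemma gpeval_gvertex i (a : Om i) : gpeval (gvertex a) = phi i a.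
Proof. exact: gpeval_gpath. Qed.

Lemma gpeval_garrow i j (x : arrow i j) :
  gpeval (garrow Om x) = phi i 1 ** (psi x ** phi j 1).
Proof. exact: gpeval_gpath. Qed.

Hypothesis phiM : forall i a b, phi i (a * b) = phi i a ** phi i b.
Hypothesis phi0 : forall i j, i <> j -> phi i 1 ** phi j 1 = 0.

Lemma opath_eval_lmul i j a (p : opath Om i j) :
  opath_eval (opath_lmul a p) = phi i a ** opath_eval p.
Proof. by case: p a => [? b|? ? ? b x p] a /=; rewrite phiM ?numulA. Qed.

Lemma opath_eval_cat i j l (p : opath Om i j) (q : opath Om j l) :
  opath_eval (opath_cat p q) = opath_eval p ** opath_eval q.
Proof.
elim: p q => [? a|? ? ? a x p IH] q /=; first exact: opath_eval_lmul.
by rewrite IH !numulA.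
Qed.

Lemma opath_eval_unit i j (p : opath Om i j) :
  opath_eval p = opath_eval p ** phi j 1 /\
  opath_eval p = phi i 1 ** opath_eval p.
Proof.
split; last by case: p => *; rewrite /= ?numulA -phiM mul1r.
elim: p => [? a|? ? ? a x p IH] /=; first by rewrite -phiM mulr1.
by rewrite {1}IH !numulA.
Qed.

(** The orthogonality of the images of the unities makes the products of
    evaluated paths that do not compose vanish, as they do in the path
    algebra. *)
Lemma gpevalM : {morph gpeval : x y / x ** y}.
Proof.
move=> x y; move: x.
apply: (@gpalg_ind [set x | gpeval (x ** y) = gpeval x ** gpeval y])
  => [|i j p].
  split=> /= [|c x x' E E']; first by rewrite numul0r linear0 numul0r.
  by rewrite numulDl numulZl !linearP /= E E' numulDl numulZl.
rewrite /=; move: y.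
apply: (@gpalg_ind
  [set y | gpeval (gpath p ** y) = gpeval (gpath p) ** gpeval y]) => [|s t q].
  split=> /= [|c y y' E E']; first by rewrite numulr0 linear0 numulr0.
  by rewrite numulDr numulZr !linearP /= E E' numulDr numulZr.
rewrite /=; have [E|ne] := pselect (j = s).
  by case: _ / E q => q; rewrite gpath_mul !gpeval_gpath opath_eval_cat.
rewrite gpath_mul0 // linear0 !gpeval_gpath.
have [-> _] := opath_eval_unit p; have [_ ->] := opath_eval_unit q.
by rewrite -numulA [phi j 1 ** _]numulA phi0 // numul0r numulr0.
Qed.

End Evaluation.

(** ** Projections onto the vertex algebras *)

Section VertexProjection.
Variable i : D.

(** The identity of [Om i] extended by zero to the other vertex algebras, in the
    form that the universal property takes as input. *)
Definition vertex_cast j (a : Om j) : nu (Om i) :=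
  match pselect (j = i) with
  | left e => ecast l (nu (Om l)) e a
  | right _ => 0
  end.

Fact vertex_cast_linear j : linear (@vertex_cast j).
Proof.
rewrite /vertex_cast; case: pselect => [E|_] c a b.
  by case: _ / E.
by rewrite scaler0 addr0.
Qed.

HB.instance Definition _ j :=
  GRing.isLinear.Build k (Om j) (nu (Om i)) _ (@vertex_cast j)
    (@vertex_cast_linear j).

Lemma vertex_cast_id (a : Om i) : vertex_cast a = a.
Proof.
rewrite /vertex_cast; case: pselect => // E.
by rewrite (Prop_irrelevance E erefl).
Qed.

Lemma vertex_cast0 j (a : Om j) : j <> i -> vertex_cast a = 0.
Proof. by rewrite /vertex_cast; case: pselect. Qed.

Definition vertex_proj : R -> nu (Om i) :=
  gpeval (fun j => vertex_cast (j:=j) : {linear Om j -> nu (Om i)})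
    (fun _ _ _ => 0).

HB.instance Definition _ := GRing.Linear.on vertex_proj.

Lemma vertex_projM : {morph vertex_proj : x y / x ** y}.
Proof.
apply: gpevalM => [j a b|j l ne] /=.
  have [E|ne] := pselect (j = i); last by rewrite !vertex_cast0 // numul0r.
  by case: _ / (esym E) a b => a b; rewrite !vertex_cast_id.
have [E|ne'] := pselect (j = i); last by rewrite vertex_cast0 // numul0r.
rewrite [vertex_cast (1 : Om l)]vertex_cast0 ?numulr0 // => E'.
by apply: ne; rewrite E E'.
Qed.

Lemma vertex_proj_id (a : Om i) : vertex_proj (gvertex a) = a.
Proof. by rewrite /vertex_proj gpeval_gvertex /= vertex_cast_id. Qed.

Lemma vertex_proj0 j (a : Om j) : j <> i -> vertex_proj (gvertex a) = 0.
Proof. by move=> ne; rewrite /vertex_proj gpeval_gvertex /= vertex_cast0. Qed.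

Lemma vertex_proj_arrow_ideal x :
  ideal_set (arrow_ideal Om) x -> vertex_proj x = 0.
Proof.
move: x; apply: (gideal_sub (is_ideal_ker vertex_projM)).
move=> _ [j [l [x ->]]].
by rewrite /= /vertex_proj gpeval_garrow numul0r numulr0.
Qed.

Lemma gvertex_mul_span x : vertex_span x ->
  gvertex (1 : Om i) ** x = gvertex (vertex_proj x : Om i).
Proof.
move: x; apply: lspan_sub => [|_ [j [a ->]]] /=.
  split=> /= [|c x y E E']; first by rewrite numulr0 !linear0.
  by rewrite numulDr numulZr E E' linearP [RHS]linearP.
have [E|ne] := pselect (j = i).
  by case: _ / (esym E) a => a; rewrite vertex_proj_id -gvertexM mul1r.
rewrite vertex_proj0 // gvertexM0 ?linear0 // => E; exact: ne.
Qed.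

End VertexProjection.

(** Left multiplication by the unity at [i] and projection onto the vertex
    algebra at [i] agree on the span of the vertex algebras. *)
Lemma vertex_span_eq0 w :
  vertex_span w -> (forall i, vertex_proj i w = 0) -> w = 0.
Proof.
move=> Vw w0; apply: (peirce_eq0 gvertex_peirce) => i.
by rewrite gvertex_mul_span // w0 linear0.
Qed.

End PathAlgebra.

(** * Unital subalgebras *)

Record unital_subalgebra (k : fieldType) (A : nuAlgType k) := UnitalSubalgebra {
  usub_set : set A;
  usub_one : A;
  usub_subalgebra : subalgebra usub_set;
  usub_one_in : usub_set usub_one;
  usub_mul1 : forall x, usub_set x -> usub_one ** x = x /\ x ** usub_one = x;
  usub_one_neq0 : usub_one <> 0
}.

Section UnitalSubalgebra.
Variables (k : fieldType) (A : nuAlgType k) (S : unital_subalgebra A).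

Record usub := Usub { usub_val : A; usubP : usub_set S usub_val }.

HB.instance Definition _ := gen_eqMixin usub.
HB.instance Definition _ := gen_choiceMixin usub.

Lemma usub_inj : injective usub_val.
Proof.
case=> x Sx [y Sy] /= E; case: _ / E Sy => Sy.
by rewrite (Prop_irrelevance Sx Sy).
Qed.

Let sS : subspace (usub_set S) := (usub_subalgebra S).1.

Definition usub_zero := Usub sS.1.
Definition usub_opp x := Usub (subspaceN sS (usubP x)).
Definition usub_add x y := Usub (subspaceD sS (usubP x) (usubP y)).
Definition usub_scale c x := Usub (subspaceZ c sS (usubP x)).
Definition usub_unit := Usub (usub_one_in S).
Definition usub_mul x y :=
  Usub ((usub_subalgebra S).2 _ _ (usubP x) (usubP y)).

Fact usub_addA : associative usub_add.
Proof. by move=> x y z; apply/usub_inj/addrA. Qed.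
Fact usub_addC : commutative usub_add.
Proof. by move=> x y; apply/usub_inj/addrC. Qed.
Fact usub_add0 : left_id usub_zero usub_add.
Proof. by move=> x; apply/usub_inj/add0r. Qed.
Fact usub_addN : left_inverse usub_zero usub_opp usub_add.
Proof. by move=> x; apply/usub_inj/addNr. Qed.

HB.instance Definition _ :=
  GRing.isZmodule.Build usub usub_addA usub_addC usub_add0 usub_addN.

Fact usub_mulA : associative usub_mul.
Proof. by move=> x y z; apply/usub_inj/numulA. Qed.
Fact usub_mul1l : left_id usub_unit usub_mul.
Proof. by move=> x; apply/usub_inj/(usub_mul1 (usubP x)).1. Qed.
Fact usub_mul1r : right_id usub_unit usub_mul.
Proof. by move=> x; apply/usub_inj/(usub_mul1 (usubP x)).2. Qed.
Fact usub_mulDl : left_distributive usub_mul +%R.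
Proof. by move=> x y z; apply/usub_inj/numulDl. Qed.
Fact usub_mulDr : right_distributive usub_mul +%R.
Proof. by move=> x y z; apply/usub_inj/numulDr. Qed.
Fact usub_unit_neq0 : usub_unit != 0.
Proof. by apply/eqP => /(congr1 usub_val); apply: usub_one_neq0. Qed.

HB.instance Definition _ := GRing.Zmodule_isNzRing.Build usub
  usub_mulA usub_mul1l usub_mul1r usub_mulDl usub_mulDr usub_unit_neq0.

Fact usub_scaleA c d x : usub_scale c (usub_scale d x) = usub_scale (c * d) x.
Proof. by apply/usub_inj/scalerA. Qed.
Fact usub_scale1 : left_id 1 usub_scale.
Proof. by move=> x; apply/usub_inj/scale1r. Qed.
Fact usub_scaleDr : right_distributive usub_scale +%R.
Proof. by move=> c x y; apply/usub_inj/scalerDr. Qed.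
Fact usub_scaleDl x : {morph usub_scale^~ x : c d / c + d}.
Proof. by move=> c d; apply/usub_inj/scalerDl. Qed.

HB.instance Definition _ := GRing.Zmodule_isLmodule.Build k usub
  usub_scaleA usub_scale1 usub_scaleDr usub_scaleDl.

Fact usub_scaleAl c (x y : usub) : c *: (x * y) = c *: x * y.
Proof. by apply/usub_inj/esym/numulZl. Qed.
HB.instance Definition _ := GRing.Lmodule_isLalgebra.Build k usub usub_scaleAl.

Fact usub_scaleAr c (x y : usub) : c *: (x * y) = x * (c *: y).
Proof. by apply/usub_inj/esym/numulZr. Qed.
HB.instance Definition _ := GRing.Lalgebra_isAlgebra.Build k usub usub_scaleAr.

Fact usub_val_linear : linear usub_val. Proof. by []. Qed.
HB.instance Definition _ :=
  GRing.isLinear.Build k usub A _ usub_val usub_val_linear.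

End UnitalSubalgebra.

Section UsubRadical.
Variables (k : fieldType) (A : nuAlgType k) (S : unital_subalgebra A).
Local Notation r := (@jradical_set k A).

(** For [U] maximal modular in [A], the elements of [S] lying in [U] form a
    maximal left ideal of [S], unless [U] contains the unity of [S] and hence
    all of [S].  The hypothesis makes [T + U] a left ideal of [A] for every left
    ideal [T] of [S]. *)
Lemma jradical_usub :
  (forall a, exists2 s, usub_set S s & r (a ** usub_one S - s)) ->
  forall x : nu (usub S), jradical_set x -> r (usub_val x).
Proof.
move=> rS x rx U mU; have [lU [e he] UnT maxU] := mU.
have rU z : r z -> U z by apply.
have [sU UM] := lU; have [U0 _] := sU.
have [U1|nU1] := pselect (U (usub_one S)).
  by rewrite -[usub_val x](usub_mul1 (usubP x)).2; apply: UM.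
apply: (rx [set z : nu (usub S) | U (usub_val z)]); split.
- split=> [|y z Uz /=]; last by apply: UM.
  exact: (subspace_preim (usub_val (S:=S) : {linear usub S -> A}) sU).
- exists (1 : usub S) => z.
  have -> : z ** (1 : usub S) = z by apply: mulr1.
  by rewrite subrr.
- apply/eqP => E; apply: nU1.
  have : [set: nu (usub S)] (1 : usub S) by [].
  by rewrite -E.
move=> T [[T0 hT] MT] UT.
have lM : is_left_ideal
    [set z | exists y u, [/\ (@usub_val _ _ S @` T) y, U u & z = y + u]].
  split.
    split; first by exists 0, 0; rewrite addr0; split=> //; exists 0.
    move=> c _ _ [_ [u [[t Tt <-] Uu ->]]] [_ [u' [[t' Tt' <-] Uu' ->]]].
    exists (c *: usub_val t + usub_val t'), (c *: u + u').
    rewrite scalerDr addrACA; split=> //; last by case: sU => _; apply.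
    by exists (c *: t + t') => //; apply: hT.
  move=> a _ [_ [u [[t Tt <-] Uu ->]]].
  have [s Ss rs] := rS a.
  exists (s ** usub_val t), ((a ** usub_one S - s) ** usub_val t + a ** u).
  split; first by exists ((Usub Ss : nu (usub S)) ** t); [apply: MT|].
    apply: (subspaceD sU); last exact: UM.
    by apply: rU; have [_ /(_ (usub_val t) _ rs) []] := jradical_is_ideal A.
  rewrite addrA numulDr numulDl numulNr -numulA (usub_mul1 (usubP t)).1.
  by rewrite [s ** _ + _]addrC subrK.
case: (maxU _ lM) => [u Uu|E|E].
- by exists 0, u; rewrite add0r; split=> //; exists 0.
- left; apply/seteqP; split=> // t Tt /=; rewrite -E.
  by exists (usub_val t), 0; rewrite addr0; split=> //; exists t.
- have : [set: A] (usub_one S) by [].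
  rewrite -E => -[_ [u [[t Tt <-] Uu oneE]]].
  have T1 : T (1 : usub S).
    rewrite -[1](subrK t) addrC -[t]scale1r; apply: hT => //.
    by apply: UT; rewrite /= scale1r oneE addrC addKr.
  right; apply/seteqP; split=> // t' _.
  by rewrite -[t'](@mulr1 (usub S)); apply: MT.
Qed.

End UsubRadical.

(** * Algebras with weak relations *)

Section WeakRelations.
Variables (k : fieldType) (D : quiver) (Om : D -> algType k).
Variables (L : nuAlgType k) (f : {linear gpalg Om -> L}) (t : nat).
Hypothesis rOm0 :
  forall i : D, jradical (nu (Om i)) = [set 0] :> set (nu (Om i)).
Hypothesis fM : {morph f : x y / x ** y}.
Hypothesis fS : forall y, exists x, f x = y.
Hypothesis t_gt0 : (0 < t)%N.
Hypothesis Jt_ker : forall x, idealX (arrow_ideal Om) t x -> f x = 0.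
Hypothesis ker_J : forall x, f x = 0 -> ideal_set (arrow_ideal Om) x.
Local Notation J := (ideal_set (arrow_ideal Om)).

Lemma image_arrow_nilpotent : nilpotent (f @` J).
Proof.
exists t; split=> // y /(idealX_image fM) [x Jx <-].
exact: Jt_ker.
Qed.

Lemma image_arrow_sub_jradical : f @` J `<=` jradical_set (A:=L).
Proof.
have [sJ mJ] := idealP (arrow_ideal Om).
apply: nil_sub_jradical => [|x]; last first.
  exact: (nilpotent_exp image_arrow_nilpotent).
split=> [|y _ [x Jx <-]]; first exact: subspace_image.
have [z <-] := fS y; exists (z ** x); last by rewrite fM.
exact: (mJ _ _ _).1.
Qed.

(** The projection onto a vertex algebra factors through [L], since its kernel
    contains [J], and the radical of the vertex algebra is zero. *)
Lemma vertex_proj_jradical i x : jradical_set (f x) -> vertex_proj i x = 0.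
Proof.
have /choice [s fs] := fS.
have pE y z : f y = f z -> vertex_proj i y = vertex_proj i z.
  move=> E; apply/eqP; rewrite -subr_eq0 -linearB; apply/eqP.
  apply: vertex_proj_arrow_ideal; apply: ker_J.
  by rewrite linearB E subrr.
have lin : linear (vertex_proj i \o s).
  by move=> c y z /=; rewrite -linearP; apply: pE; rewrite linearP !fs.
pose h := HB.pack_for {linear L -> nu (Om i)} (vertex_proj i \o s)
  (GRing.isLinear.Build k L (nu (Om i)) _ (vertex_proj i \o s) lin).
have hE y : h (f y) = vertex_proj i y by apply: pE; rewrite fs.
have hM : {morph h : y z / y ** z}.
  by move=> y z /=; rewrite -vertex_projM; apply: pE; rewrite fM !fs.
have hS a : exists y, h y = a.
  by exists (f (gvertex (a : Om i))); rewrite hE vertex_proj_id.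
move=> /(jradical_surj hM hS); rewrite hE.
suff E : jradical_set (A:=nu (Om i)) = [set 0] by rewrite E.
exact: rOm0.
Qed.

(** Write a preimage of an element of the radical as [w + j] with [j] in [J];
    all projections of [w] onto the vertex algebras vanish. *)
Lemma jradical_image : jradical_set (A:=L) = f @` J.
Proof.
apply/seteqP; split=> [y ry|]; last exact: image_arrow_sub_jradical.
have [x yE] := fS y; rewrite -yE in ry *.
have [w [j [Vw Jj xE]]] := gpalg_decomp x.
suff w0 : w = 0 by exists j; rewrite // xE w0 add0r.
apply: vertex_span_eq0 => // i.
rewrite -(addrK j w) -xE linearB /=.
by rewrite vertex_proj_jradical // vertex_proj_arrow_ideal // subrr.
Qed.

Lemma weak_relations_liftable : liftable L.
Proof.
exists (f @` @vertex_span _ _ Om); split.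
- split=> [|_ _ [x Vx <-] [y Vy <-]].
    exact/subspace_image/subspace_vertex_span.
  by exists (x ** y); rewrite ?fM //; apply: vertex_spanM.
- apply/seteqP; split=> [_ [[w Vw <-] /= rw]|_ ->] /=.
    rewrite (vertex_span_eq0 Vw) ?linear0 // => i.
    exact: vertex_proj_jradical.
  split; last by have [[]] := jradical_is_ideal L.
  by exists 0; rewrite ?linear0 //; case: (subspace_vertex_span Om).
move=> y; have [x <-] := fS y; have [w [j [Vw Jj ->]]] := gpalg_decomp x.
exists (f w), (f j); rewrite linearD; split=> //.
by rewrite jradical_image; exists j.
Qed.

Lemma weak_relations_gm_unit : inhabited D ->
  gm_unit (fun i : D => f (gvertex (1 : Om i))).
Proof.
move=> iD; apply/gm_unitP; split=> //.
  exact: (peirce_surj fM fS (gvertex_peirce Om)).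
move=> i /ker_J /(vertex_proj_arrow_ideal i).
by rewrite vertex_proj_id => /eqP; apply/negP/oner_neq0.
Qed.

Lemma weak_relations_central i :
  central (proj (jradical L) (f (gvertex (1 : Om i)))).
Proof.
have [sr mr] := jradical_is_ideal L.
elim/quot_ind=> y; apply: etrans (qmulE _ _ _) _; apply/esym.
apply: etrans (qmulE _ _ _) _; apply/proj_eqP.
have [x <-] := fS y; have [w [j [Vw Jj ->]]] := gpalg_decomp x.
have rj : jradical_set (f j) by rewrite jradical_image; exists j.
rewrite linearD numulDl numulDr -!fM vertex_span_central // opprD addrACA subrr.
rewrite add0r !fM; apply: (subspaceB sr); first exact: (mr _ _ _).2.
exact: (mr _ _ _).1.
Qed.

End WeakRelations.

(** * Lifting idempotents *)

Section LiftIdempotents.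
Variables (k : fieldType) (L : nuAlgType k) (I : Type) (e : I -> L) (B : set L).
Local Notation r := (@jradical_set k L).
Hypothesis sB : subalgebra B.
Hypothesis Br0 : B `&` r = [set 0].
Hypothesis Br : forall x, exists y z, [/\ B y, r z & x = y + z].
Hypothesis nil_r : nilpotent r.
Hypothesis eP : peirce_system e.
Hypothesis e_neq0 : forall i, e i <> 0.
Hypothesis e_central : forall i x, r (e i ** x - x ** e i).

Let sr : subspace r := (jradical_is_ideal L).1.
Let rMl x y : r y -> r (x ** y).
Proof. by move=> ry; apply: ((jradical_is_ideal L).2 _ _ _).1. Qed.
Let rMr x y : r x -> r (x ** y).
Proof. by move=> rx; apply: ((jradical_is_ideal L).2 _ _ _).2. Qed.

Lemma eq_mod_jradical x y : B x -> B y -> r (x - y) -> x = y.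
Proof.
move=> Bx By rxy; apply/eqP; rewrite -subr_eq0; apply/eqP.
have : (B `&` r) (x - y) by split=> //; apply: (subspaceB sB.1).
by rewrite Br0.
Qed.

Lemma jradicalM x x' y y' : r (x - x') -> r (y - y') -> r (x ** y - x' ** y').
Proof.
move=> rx ry; rewrite -(subrKA (x ** y')).
rewrite -[- (x ** y')]numulrN -[- (x' ** y')]numulNr -numulDr -numulDl.
by apply: (subspaceD sr); [apply: rMl | apply: rMr].
Qed.

(** Congruence modulo [r] is equality on [B], so that the identities satisfied
    by the [e i] modulo [r] hold for their representatives in [B].  That the
    [b i] decompose [L] is not inherited in this way: it uses the nilpotency of
    the radical. *)
Lemma lift_idempotents : exists b : I -> L,
  [/\ forall i, B (b i),
      forall i x, B x -> b i ** x = x ** b i, forall i, b i <> 0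
    & peirce_system b].
Proof.
have [e_id e0 span_e] := eP; have [sB0 mB] := sB.
have /choice [b bP] : forall i, exists b, B b /\ r (e i - b).
  move=> i; have [y [z [By rz ->]]] := Br (e i).
  by exists y; rewrite addrC addKr.
have Bb i : B (b i) by case: (bP i).
have rb i : r (e i - b i) by case: (bP i).
have rb' i : r (b i - e i) by rewrite -opprB; apply: (subspaceN sr).
have r0 : r 0 by case: sr.
have b_id i : b i ** b i = b i.
  apply: eq_mod_jradical; [exact: mB|exact: Bb|].
  rewrite -(subrKA (e i)); apply: (subspaceD sr) => //.
  by rewrite -e_id; apply: jradicalM.
have b0 i j : i <> j -> b i ** b j = 0.
  move=> ne; apply: eq_mod_jradical; [exact: mB|by case: sB0|].
  by rewrite -(e0 _ _ ne); apply: jradicalM.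
have bC i x : B x -> b i ** x = x ** b i.
  move=> Bx; apply: eq_mod_jradical; [exact: mB|exact: mB|].
  rewrite -(subrKA (e i ** x)); apply: (subspaceD sr).
    by apply: jradicalM; rewrite ?subrr.
  rewrite -(subrKA (x ** e i)); apply: (subspaceD sr) => //.
  by apply: jradicalM; rewrite ?subrr.
exists b; split=> // [i bi0|].
  apply: (e_neq0 (i := i)); apply: (nilpotent_idempotent nil_r) => //.
  by have := rb i; rewrite bi0 subr0.
split=> // x.
set M := lspan _; have sM : subspace M by apply: subspace_lspan.
(* Modulo [r U + U r], an element [e_i z e_j] of [U] is [b_i e_i z e_j b_j]. *)
have step (U U' : set L) : is_ideal U -> subspace U' ->
    (forall x y, r x -> U y -> U' (x ** y)) ->
    (forall x y, U x -> r y -> U' (x ** y)) -> U' `<=` M -> U `<=` M.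
  move=> [sU mU] sU' rUU' UrU' U'M z Uz.
  have [u Pu [uz zu]] := local_unit eP z.
  rewrite -uz -zu numulA.
  suff : forall u v, lspan (range e) u -> lspan (range e) v ->
    M (u ** z ** v) by apply.
  move=> {u Pu uz zu} u v Pu Pv; move: u Pu.
  apply: lspan_sub => [|_ [i _ <-]] /=.
    exact: (subspace_mulr z (subspace_mulr v sM)).
  move: v Pv; apply: lspan_sub => [|_ [j _ <-]] /=; first exact: subspace_mull.
  set y := e i ** z ** e j.
  have Uy : U y by apply: (mU _ _ _).2; apply: (mU _ _ _).1.
  have ey : e i ** y = y by rewrite /y !numulA e_id.
  have ye : y ** e j = y by rewrite /y -numulA e_id.
  have -> : y = b i ** y ** b j
      + ((e i - b i) ** y + (b i ** y) ** (e j - b j)).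
    rewrite numulDr numulrN -[b i ** y ** e j]numulA ye.
    by rewrite numulDl numulNr ey subrKA addrC addrNK.
  apply: (subspaceD sM).
    apply: sub_lspan; exists i, j.
    by rewrite !numulA b_id -!numulA b_id.
  apply: U'M; apply: (subspaceD sU'); first exact: rUU'.
  by apply: UrU' => //; apply: (mU _ _ _).1.
have [n [n_gt0 rn0]] := nil_r.
have rM m : idealX r m.+1 `<=` M -> r `<=` M.
  elim: m => [|m IH] // rmM; apply: IH.
  apply: step rmM => [||y z|y z].
  - exact/idealX_ideal/jradical_is_ideal.
  - exact: subspace_lspan.
  - exact: idealXS.
  - exact: idealXSr.
apply: (step setT r) => // [y z ry _|y z _|]; [exact: rMr|exact: rMl|].
apply: (rM n.-1); rewrite prednK // => y /rn0 ->.
by case: sM.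
Qed.

End LiftIdempotents.

(** * Presentation by paths *)

Section PathPresentation.
Variables (k : fieldType) (L : nuAlgType k) (I : Type) (b : I -> L) (B : set L).
Local Notation r := (@jradical_set k L).
Hypothesis sB : subalgebra B.
Hypothesis Br0 : B `&` r = [set 0].
Hypothesis Br : forall x, exists y z, [/\ B y, r z & x = y + z].
Hypothesis nil_r : nilpotent r.
Hypothesis bP : peirce_system b.
Hypothesis b_neq0 : forall i, b i <> 0.
Hypothesis Bb : forall i, B (b i).
Hypothesis bC : forall i x, B x -> b i ** x = x ** b i.

Let b_id i : b i ** b i = b i. Proof. by have [] := bP. Qed.

Lemma corner_subalgebra i : subalgebra [set x | B x /\ b i ** x = x].
Proof.
have [sB0 mB] := sB.
split=> [|x y [Bx bx] [By _]]; last by split; [exact: mB | rewrite numulA bx].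
split=> [|c x y [Bx bx] [By bY]]; first by split; [case: sB0|rewrite numulr0].
by split; [case: sB0 => _; apply | rewrite numulDr numulZr bx bY].
Qed.

Definition corner i : unital_subalgebra L :=
  @UnitalSubalgebra _ L [set x | B x /\ b i ** x = x] (b i)
    (corner_subalgebra i) (conj (Bb i) (b_id i))
    (fun x '(conj Bx bx) => conj bx (etrans (esym (bC i Bx)) bx)) (@b_neq0 i).

(** Taking all elements of [b_i r b_j] as arrows, rather than representatives of
    a basis modulo the square of [r], puts each [b_i r b_j] in the image of
    the presentation at once. *)
Definition radical_quiver : quiver :=
  @Quiver I (fun i j => {x : L | [/\ r x, b i ** x = x & x ** b j = x]}).

Definition corner_alg (i : radical_quiver) : algType k := usub (corner i).

Definition presentation : gpalg corner_alg -> L :=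
  gpeval (fun i => usub_val (S := corner i) : {linear corner_alg i -> L})
    (fun i j (x : @arrow radical_quiver i j) => sval x).

HB.instance Definition _ := GRing.Linear.on presentation.

Lemma presentation_gvertex i (a : corner_alg i) :
  presentation (gvertex a) = usub_val a.
Proof. exact: gpeval_gvertex. Qed.

Lemma presentation_garrow i j (x : @arrow radical_quiver i j) :
  presentation (garrow corner_alg x) = sval x.
Proof.
rewrite /presentation gpeval_garrow /=.
by case: x => x [rx bx xb] /=; rewrite xb bx.
Qed.

Lemma presentationM : {morph presentation : x y / x ** y}.
Proof. by apply: gpevalM => // i j ne; have [_ b0 _] := bP; apply: b0. Qed.

Lemma presentation_surj y : exists x, presentation x = y.
Proof.
have [_ mB] := sB; have [_ _ span_b] := bP.
suff : (range presentation) y by case=> x _; exists x.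
move: y (span_b y); apply: lspan_sub => [|y [i [j [bY yb]]]].
  by apply: subspace_image; split.
have [y1 [y2 [By1 ry2 yE]]] := Br y.
have B1 : B (b i ** y1 ** b j) by apply: (mB) => //; apply: mB.
have c1 : b i ** (b i ** y1 ** b j) = b i ** y1 ** b j by rewrite !numulA b_id.
pose a : corner_alg i := @Usub _ _ (corner i) _ (conj B1 c1).
have [_ mr] := jradical_is_ideal L.
have r2 : [/\ r (b i ** y2 ** b j), b i ** (b i ** y2 ** b j) = b i ** y2 ** b j
    & b i ** y2 ** b j ** b j = b i ** y2 ** b j].
  split; [|by rewrite !numulA b_id|by rewrite -!numulA b_id].
  by apply: (mr _ _ _).2; apply: (mr _ _ _).1.
pose x : @arrow radical_quiver i j := exist _ (b i ** y2 ** b j) r2.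
exists (gvertex a + garrow corner_alg x) => //.
rewrite linearD /= presentation_gvertex presentation_garrow /=.
by rewrite -numulDl -numulDr -yE bY yb.
Qed.

Lemma presentation_vertex_span w :
  vertex_span w -> B (presentation w).
Proof.
move: w; apply: lspan_sub => [|_ [i [a ->]]] /=.
  exact: (subspace_preim _ sB.1).
by rewrite presentation_gvertex; have [] := usubP a.
Qed.

Lemma presentation_arrow_ideal x :
  ideal_set (arrow_ideal corner_alg) x -> r (presentation x).
Proof.
move: x; apply: gideal_sub.
  exact: (is_ideal_preim presentationM (jradical_is_ideal L)).
move=> _ [i [j [x ->]]].
by rewrite /= presentation_garrow; case: (svalP x).
Qed.

(** The presentation is injective on the span of the vertex algebras, which it
    maps to the complement [B] of the radical. *)
Lemma ker_presentation x :
  presentation x = 0 -> ideal_set (arrow_ideal corner_alg) x.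
Proof.
have [w [j [Vw Jj ->]]] := gpalg_decomp x; rewrite linearD /= => E.
suff -> : w = 0 by rewrite add0r.
have w0 : presentation w = 0.
  have : (B `&` r) (presentation w); last by rewrite Br0.
  split; first exact: presentation_vertex_span.
  move/eqP: E; rewrite addr_eq0 => /eqP ->.
  apply: (subspaceN (jradical_is_ideal L).1).
  exact: presentation_arrow_ideal.
apply: vertex_span_eq0 => // i; apply: usub_inj.
rewrite -presentation_gvertex -gvertex_mul_span // presentationM w0.
by rewrite numulr0.
Qed.

(** Modulo [r], every element of [L] lies in [B], and [B b_i] is the vertex
    algebra at [i]; so the radical of the latter lies in [r], which meets [B]
    only in zero. *)
Lemma corner_jradical i :
  jradical (nu (corner_alg i)) = [set 0] :> set (nu (corner_alg i)).
Proof.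
have [_ mr] := jradical_is_ideal L; have [_ mB] := sB.
apply/seteqP; split=> [x rx|_ ->] /=; last first.
  by have [[]] := jradical_is_ideal (nu (corner_alg i)).
apply: usub_inj.
suff : (B `&` r) (usub_val (x : corner_alg i)) by rewrite Br0.
split; first by have [] := usubP (x : corner_alg i).
apply: jradical_usub rx => a; have [y [z [By rz ->]]] := Br a.
exists (y ** b i).
  by split; [exact: mB | rewrite numulA (bC i By) -numulA b_id].
rewrite numulDl addrC addKr; exact: (mr _ _ _).2.
Qed.

Lemma weak_presentation : inhabited I ->
  exists (D : quiver) (Om : D -> algType k) (rho : set (gpalg Om)),
    [/\ inhabited D,
        forall i : D, jradical (nu (Om i)) = [set 0] :> set (nu (Om i)),
        rho !=set0,
        weak_relations rho
      & nu_isomorphic L (quot (gideal rho))].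
Proof.
move=> iI; exists radical_quiver, corner_alg, [set x | presentation x = 0].
have kE x : ideal_set (gideal [set x | presentation x = 0]) x <->
    presentation x = 0.
  split=> [|E]; last exact: sub_gideal.
  exact: (gideal_sub (is_ideal_ker presentationM)).
split=> //; first exact: corner_jradical.
- by exists 0; rewrite /= linear0.
- split=> [|x /kE]; last exact: ker_presentation.
  have [t [t_gt0 rt0]] := nil_r; exists t; split=> // x Jx; apply/kE.
  apply: rt0; apply: (idealX_morph presentationM) Jx.
  exact: presentation_arrow_ideal.
exact: (nu_isomorphic_quot presentationM presentation_surj kE).
Qed.

End PathPresentation.

Theorem theorem3p8 (k : fieldType) (L : nuAlgType k) :
  [/\ liftable L,
      nilpotent (jradical L)
    & exists (I : Type) (e : I -> L),
        gm_unit e /\ forall i : I, central (proj (jradical L) (e i))]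
  <->
  exists (D : quiver) (Om : D -> algType k) (rho : set (gpalg Om)),
    [/\ inhabited D,
        forall i : D, jradical (nu (Om i)) = [set 0] :> set (nu (Om i)),
        rho !=set0,
        weak_relations rho
      & nu_isomorphic L (quot (gideal rho))].
Proof.
split=> [[[B [sB Br0 Br]] nil_r [I [e [/gm_unitP [iI eP e_neq0] e_central]]]]|].
  have eC i x : jradical_set (e i ** x - x ** e i).
    apply/(proj_eqP (jradical L)).
    apply: etrans (esym (qmulE _ _ _)) _.
    by apply: etrans (e_central i _) _; apply: qmulE.
  have [b [Bb bC b_neq0 bP]] :=
    lift_idempotents sB Br0 Br nil_r eP e_neq0 eC.
  exact: (weak_presentation sB Br0 Br nil_r bP b_neq0 Bb bC iI).
move=> [D [Om [rho [iD rOm0 _ [[t [t_gt0 Jt]] rhoJ] /nu_isomorphic_quotE]]]].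
move=> [f [fM fS kerf]].
have Jt_ker x : idealX (arrow_ideal Om) t x -> f x = 0 by move=> /Jt /kerf.
have ker_J x : f x = 0 -> ideal_set (arrow_ideal Om) x by move=> /kerf /rhoJ.
split.
- exact: (weak_relations_liftable rOm0 fM fS t_gt0 Jt_ker ker_J).
- have E := jradical_image rOm0 fM fS t_gt0 Jt_ker ker_J.
  rewrite /= /nilpotent /= E.
  exact: (image_arrow_nilpotent fM t_gt0 Jt_ker).
exists D, (fun i : D => f (gvertex (1 : Om i))); split.
  exact: (weak_relations_gm_unit fM fS ker_J iD).
exact: (weak_relations_central rOm0 fM fS t_gt0 Jt_ker ker_J).
Qed.
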